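(* Let $\mathbb{K}$ be a quadratically closed field of characteristic different from $2$. Let $\mathcal{E}_1,\dots,\mathcal{E}_r$ ($r\geq 1$) be solvable non-nilpotent evolution algebras over $\mathbb{K}$, each of the form $\mathcal{E}_k(\lambda_1,\dots,\lambda_s)$, and let $\mathcal{E}$ be a solvable non-nilpotent evolution algebra of the family $\mathcal{F}(\mathcal{E}_1,\dots,\mathcal{E}_r)$, with $n=\dim\mathcal{E}$. Then the following statements are equivalent: (i) $\mathcal{E}$ is distributive; (ii) $\mathcal{E}$ is modular (and, consequently, upper semimodular); (iii) $r=1$, $\mathcal{E}_1\cong\mathcal{E}_2(1,-1)$ and the quotient $\mathcal{E}/\mathcal{E}_1^2$ is a nilpotent evolution algebra with maximum index of nilpotency; (iv) $\mathcal{E}$ has maximum index of solvability. In this case, there exists a natural basis $B$ of $\mathcal{E}$ such that the structure matrix is $$M_B(\mathcal{E})=\begin{pmatrix} A_{2\times 2}&0_{2\times(n-2)}\\ C_{(n-2)\times 2}&L_{(n-2)\times(n-2)}\end{pmatrix},$$ where $A=\begin{pmatrix}1&1\\-1&-1\end{pmatrix}$, $L$ is strictly lower triangular with no zeros in its first lower diagonal, and $M_B(\mathcal{E})$ has rank $n-1$.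
   Context: An evolution algebra over a field $\mathbb{K}$ is a finite-dimensional $\mathbb{K}$-algebra $\mathcal{E}$ (bilinear product, not necessarily associative) admitting a basis $B=\{e_1,\dots,e_n\}$, called a natural basis, with $e_ie_j=0$ for $i\neq j$; writing $e_i^2=\sum_k a_{ik}e_k$, the structure matrix is $M_B(\mathcal{E})=(a_{ik})$. Quotients of evolution algebras by ideals are evolution algebras. $\mathcal{E}^2$ denotes the span of all products. Put $\mathcal{E}^1=\mathcal{E}$, $\mathcal{E}^{k+1}=\sum_{i=1}^k\mathcal{E}^i\mathcal{E}^{k+1-i}$, and $\mathcal{E}^{(1)}=\mathcal{E}$, $\mathcal{E}^{(k+1)}=\mathcal{E}^{(k)}\mathcal{E}^{(k)}$. $\mathcal{E}$ is nilpotent (resp. solvable) if some $\mathcal{E}^k=0$ (resp. some $\mathcal{E}^{(k)}=0$); the least such $k$ is the index of nilpotency (resp. solvability). An $n$-dimensional solvable evolution algebra has maximum index of solvability if the index is $n+1$ (the largest possible). An $n$-dimensional nilpotent evolution algebra has maximum index of nilpotency if its index of nilpotency is the largest possible among $n$-dimensional nilpotent evolution algebras (known: for a nilpotent algebra this is equivalent to having maximum index of solvability, and to all entries of the first upper (lower) diagonal being non-zero when the structure matrix is strictly upper (lower) triangular). The algebras $\mathcal{E}_k(\lambda_1,\dots,\lambda_s)$: for $\operatorname{char}\mathbb{K}\neq2$, $1\leq k\leq s$ and scalars $\lambda_1,\dots,\lambda_s\in\mathbb{K}$, not all zero, with $\sum_{j=1}^k\lambda_j=0$, this is the evolution algebra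 with natural basis $\{e_1,\dots,e_s\}$ and $e_i^2=\lambda_i(e_1+\dots+e_k)$ for $1\leq i\leq s$. In particular $\mathcal{E}_2(1,-1)$ has basis $\{e_1,e_2\}$ with $e_1^2=-e_2^2=e_1+e_2$. The family $\mathcal{F}(\mathcal{E}_1,\dots,\mathcal{E}_r)$: given algebras $\mathcal{E}_1,\dots,\mathcal{E}_r$ ($r\geq1$), each of the form $\mathcal{E}_k(\lambda_1,\dots,\lambda_s)$ (where $k$, $s$ and the scalars $\lambda_1,\dots,\lambda_s$ may differ from one algebra to another), with natural bases $B_1,\dots,B_r$ respectively, an evolution algebra $\mathcal{E}$ belongs to it if there is a natural basis $B$ of $\mathcal{E}$ with $\bigcup_{i=1}^rB_i\subseteq B$ and (in a suitable order) $M_B(\mathcal{E})=\begin{pmatrix}A_{m\times m}&0\\ C&L\end{pmatrix}$, where $m=|\bigcup_{i=1}^rB_i|$, $A$ is block diagonal with blocks $M_{B_i}(\mathcal{E}_i)$, $1\le i\le r$, $L$ is strictly lower triangular of size $n-m$, and $C$ is any matrix. Thus $\bigoplus_i\mathcal{E}_i$ is an ideal of $\mathcal{E}$ with nilpotent quotient. $\langle S\rangle$ denotes the subalgebra generated by $S$. $\mathcal{E}$ is distributive if $\langle U,V\cap W\rangle=\langle U,V\rangle\cap\langle U,W\rangle$ for all subalgebras $U,V,W$; modular if $\langle U,V\cap W\rangle=\langle U,V\rangle\cap W$ for all subalgebras $U,V,W$ with $U\subseteq W$; upper semimodular if for all subalgebras $U,V$ such that $U\cap V$ is a maximal subalgebra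 of $V$, $U$ is a maximal subalgebra of $\langle U,V\rangle$. A field is quadratically closed if every element is a square. *)

(* Defs.v *)
From HB Require Import structures.
From mathcomp Require Import all_boot all_order all_algebra.

Set Implicit Arguments.
Unset Strict Implicit.
Unset Printing Implicit Defensive.

Import GRing.Theory.
Local Open Scope ring_scope.

HB.mixin Record hasAlgMul (K : fieldType) A of Vector K A := {
  almul : {bilinear A -> A -> A}
}.

(* Finite-dimensional algebras: the product is only assumed to be bilinear. *)
#[short(type="naAlgType")]
HB.structure Definition NAAlg (K : fieldType) :=
  {A of hasAlgMul K A & Vector K A}.

Reserved Notation "x ** y" (at level 40, left associativity).
Notation "x ** y" := (almul x y) : ring_scope.

Section Products.
Variables (K : fieldType) (E : naAlgType K).
Implicit Types (U V W I : {vspace E}) (x y : E).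

(* The span of all products u ** v with u in U and v in V (see [prodsP]). *)
Definition prods U V : {vspace E} :=
  <<[seq u ** v | u <- vbasis U, v <- vbasis V]>>%VS.

Lemma mem_prods U V x y : x \in U -> y \in V -> x ** y \in prods U V.
Proof.
move=> xU yV; rewrite (coord_vbasis xU) (coord_vbasis yV).
rewrite linear_sumlz rpred_sum // => i _.
rewrite linear_sumr rpred_sum // => j _.
rewrite linearZl_LR linearZr_LR !rpredZ // memv_span //.
by apply/allpairsP; exists ((vbasis U)`_i, (vbasis V)`_j); rewrite !mem_nth ?size_tuple.
Qed.

Lemma prodsP U V W :
  reflect {in U & V, forall x y, x ** y \in W} (prods U V <= W)%VS.
Proof.
apply: (iffP idP) => [/subvP sUVW x y xU yV|UVW].
  exact/sUVW/mem_prods.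
apply/span_subvP => _ /allpairsP[[x y] [/= xU yV ->]].
by apply: UVW; apply: vbasis_mem.
Qed.

(* E^2 *)
Definition alg_square : {vspace E} := prods fullv fullv.

Definition subalgebra U : bool := (prods U U <= U)%VS.

Definition ideal I : bool := (prods I fullv <= I)%VS && (prods fullv I <= I)%VS.

(* The subalgebra generated by U: every iteration that is not stationary
   raises the dimension, so that \dim E of them suffice (see [algenP]). *)
Definition algen U : {vspace E} :=
  iter (\dim {: E}) (fun V => V + prods V V)%VS U.

Lemma sub_algen U : (U <= algen U)%VS.
Proof.
rewrite /algen; elim: (\dim _) => [|m IHm] //=.
exact: subv_trans IHm (addvSl _ _).
Qed.

Lemma algen_min U V : (U <= V)%VS -> subalgebra V -> (algen U <= V)%VS.
Proof.
move=> sUV /prodsP algV; rewrite /algen; elim: (\dim _) => [|m IHm] //=.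
rewrite subv_add IHm; apply/prodsP => x y xU yU.
by apply: algV; apply: (subvP IHm).
Qed.

Lemma algen_subalgebra U : subalgebra (algen U).
Proof.
rewrite /algen; set f := fun V => _.
have fix_sub V : f V = V -> subalgebra V.
  by move=> fV; rewrite /subalgebra -{3}fV addvSr.
apply: (fix_sub); pose g m := iter m f U.
have gS m : (g m <= g m.+1)%VS by apply: addvSl.
have [m le_m fix_m] : exists2 m, (m <= \dim {: E})%N & g m.+1 = g m.
  case: (altP (@existsP 'I_(\dim {: E}).+1 (fun m => g m.+1 == g m))).
    by case=> m /eqP gm; exists m; rewrite // -ltnS.
  rewrite negb_exists => /forallP nofix.
  suff dimg m : (m <= (\dim {: E}).+1)%N -> (m <= \dim (g m))%N.
    by have := leq_trans (dimg _ (leqnn _)) (dimvS (subvf _)); rewrite ltnn.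
  elim: m => // m IHm lt_m; apply: leq_ltn_trans (IHm (ltnW lt_m)) _.
  rewrite ltn_neqAle dimvS ?gS // andbT; apply/eqP => eq_dim.
  have /negP[] := nofix (Ordinal lt_m).
  by rewrite eq_sym eqEdim gS -eq_dim leqnn.
have stat j : g (j + m)%N = g m by elim: j => // j IHj; rewrite addSn /g /= -/(g _) IHj.
by rewrite -/(g _) -(subnK le_m) stat.
Qed.

Lemma algenP U V : subalgebra V -> (algen U <= V)%VS = (U <= V)%VS.
Proof.
move=> algV; apply/idP/idP => [|/algen_min->//].
exact/subv_trans/sub_algen.
Qed.

(* The subalgebra generated by the union of U and V. *)
Definition aljoin U V : {vspace E} := algen (U + V).

(* The list of E^1, ..., E^k.+1; the powers E^k are characterized by
   [npow1] and [npowS]. *)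
Fixpoint npows (k : nat) : seq {vspace E} :=
  if k is k'.+1 then
    let s := npows k' in
    rcons s (\sum_(i < k) prods (nth 0%VS s i) (nth 0%VS s (k' - i)))%VS
  else [:: fullv].

(* E^k is only meaningful for 0 < k. *)
Definition npow k : {vspace E} := nth 0%VS (npows k.-1) k.-1.

Lemma npow1 : npow 1 = fullv. Proof. by []. Qed.

Lemma npowS k : (0 < k)%N ->
  npow k.+1 = (\sum_(1 <= i < k.+1) prods (npow i) (npow (k.+1 - i)))%VS.
Proof.
case: k => // k _; have szn j : size (npows j) = j.+1.
  by elim: j => //= j; rewrite size_rcons => ->.
have nthn j m : (j <= m)%N -> nth 0%VS (npows m) j = npow j.+1.
  elim: m => [|m IHm]; first by rewrite leqn0 => /eqP->.
  rewrite leq_eqVlt => /predU1P[-> //|lt_jm].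
  by rewrite [npows _]/= nth_rcons szn lt_jm IHm.
rewrite {1}/npow [npows _]/= nth_rcons szn ltnn eqxx big_add1 big_mkord.
by apply: eq_bigr => i _; rewrite !nthn ?leq_subr -1?ltnS // !subSS subSn // -ltnS.
Qed.

(* The derived series E^(k), only meaningful for 0 < k. *)
Definition spow k : {vspace E} := iter k.-1 (fun U => prods U U) fullv.

Definition nilpotent_alg := exists2 k, (0 < k)%N & npow k = 0%VS.
Definition solvable_alg := exists2 k, (0 < k)%N & spow k = 0%VS.

Definition nilpotency_index k :=
  [/\ (0 < k)%N, npow k = 0%VS & forall j, (0 < j < k)%N -> npow j != 0%VS].
Definition solvability_index k :=
  [/\ (0 < k)%N, spow k = 0%VS & forall j, (0 < j < k)%N -> spow j != 0%VS].

Definition max_solvability_index := solvability_index (\dim {: E}).+1.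

Definition natural_basis n (B : n.-tuple E) :=
  basis_of fullv B /\ forall i j, i != j -> tnth B i ** tnth B j = 0.

Definition structure_mx n (B : n.-tuple E) : 'M[K]_n :=
  \matrix_(i, k) coord B k (tnth B i ** tnth B i).

Definition evolution := exists n (B : n.-tuple E), natural_basis B.

Definition distributive_alg := forall U V W,
  subalgebra U -> subalgebra V -> subalgebra W ->
  aljoin U (V :&: W) = (aljoin U V :&: aljoin U W)%VS.

Definition modular_alg := forall U V W,
  subalgebra U -> subalgebra V -> subalgebra W -> (U <= W)%VS ->
  aljoin U (V :&: W) = (aljoin U V :&: W)%VS.

Definition maximal_subalgebra U V :=
  [/\ subalgebra U, (U <= V)%VS, U != V &
      forall W, subalgebra W -> (U <= W <= V)%VS -> W = U \/ W = V].

Definition upper_semimodular_alg := forall U V,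
  subalgebra U -> subalgebra V -> maximal_subalgebra (U :&: V) V ->
  maximal_subalgebra U (aljoin U V).

End Products.

Definition max_nilpotency_index (K : fieldType) (E : naAlgType K) :=
  evolution E /\
  exists2 k, nilpotency_index E k &
    forall (F : naAlgType K) j, \dim {: F} = \dim {: E} ->
      evolution F -> nilpotency_index F j -> (j <= k)%N.

Definition alg_iso (K : fieldType) (E F : naAlgType K) :=
  exists2 f : {linear E -> F}, bijective f & {morph f : x y / x ** y}.

(* The quotient E / I by an ideal I, carried by the complement I^C of I: the
   canonical projection removes the component along I (see [quot_proj_eq0],
   [quot_proj_surj] and [quot_projM]). *)
Section Quotient.
Variables (K : fieldType) (E : naAlgType K) (I : {vspace E}).

Definition quot_alg := subvs_of (I^C)%VS.
HB.instance Definition _ := Vector.on quot_alg.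

Definition quot_proj (x : E) : quot_alg := vsproj (I^C)%VS (x - projv I x).

Fact quot_proj_linear : linear quot_proj.
Proof.
move=> a x y; rewrite /quot_proj linearP.
by rewrite opprD addrACA -scalerBr linearP.
Qed.
HB.instance Definition _ := GRing.isSemilinear.Build K E quot_alg _ quot_proj
  (GRing.semilinear_linear quot_proj_linear).

Lemma quot_projK x : vsval (quot_proj x) = x - projv I x.
Proof. by rewrite /quot_proj vsprojK ?memv_projC. Qed.

Lemma quot_proj_eq0 x : (quot_proj x == 0) = (x \in I).
Proof.
rewrite -(inj_eq val_inj) /= quot_projK subr_eq0.
apply/eqP/idP => [->|/projv_id->//]; exact: memv_proj.
Qed.

Lemma vsval_quotK : cancel (fun u : quot_alg => vsval u) quot_proj.
Proof.
move=> u; rewrite /quot_proj; have := subvsP u.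
move: (vsval u) (vsvalK u) => x <- xIC.
congr vsproj; suff -> : projv I x = 0 by rewrite subr0.
apply/eqP; rewrite -memv0 -(capv_compl I) memv_cap memv_proj /=.
by rewrite -[projv I x](subKr x) rpredB ?memv_projC.
Qed.

Lemma quot_proj_surj (u : quot_alg) : exists x, quot_proj x = u.
Proof. by exists (vsval u); apply: vsval_quotK. Qed.

Definition quot_mul (u v : quot_alg) : quot_alg := quot_proj (vsval u ** vsval v).

Fact quot_mul_bilinear : bilinear_for *:%R *:%R quot_mul.
Proof.
split=> w a u v; rewrite /quot_mul linearP; first by rewrite linearPl linearP.
by rewrite !linearP.
Qed.
HB.instance Definition _ := bilinear_isBilinear.Build K quot_alg quot_alg quot_alg
  *:%R *:%R quot_mul quot_mul_bilinear.
HB.instance Definition _ := hasAlgMul.Build K quot_alg quot_mul.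

Lemma quot_projM : ideal I -> {morph quot_proj : x y / x ** y}.
Proof.
case/andP=> /prodsP idl /prodsP idr x y.
change (quot_proj (x ** y) = quot_mul (quot_proj x) (quot_proj y)).
rewrite /quot_mul !quot_projK; apply/eqP; rewrite -subr_eq0 -linearB quot_proj_eq0.
set px := projv I x; set py := projv I y.
have -> : x ** y - (x - px) ** (y - py) = px ** y + (x - px) ** py.
  rewrite (linearBr (@almul K E) (x - px) y py) (linearBl (@almul K E) y x px).
  by rewrite !opprB addrCA [_ + (px ** y - _)]addrCA subrr addr0 addrC.
by apply: rpredD; [apply: idl | apply: idr]; rewrite ?memvf ?memv_proj.
Qed.

End Quotient.
Arguments quot_alg {K E} I.

(* The evolution algebra on K^n whose structure matrix in the canonical basis
   is M (see [evo_stdP]). *)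
Definition evo_alg (K : fieldType) n (M : 'M[K]_n) := 'rV[K]_n.

Section EvoAlg.
Variables (K : fieldType) (n : nat) (M : 'M[K]_n).

Local Notation A := (evo_alg M).
HB.instance Definition _ := Vector.on A.

Definition evo_mul (x y : A) : A := (\row_i (x 0 i * y 0 i)) *m M.

Fact evo_mul_bilinear : bilinear_for *:%R *:%R evo_mul.
Proof.
split=> w a u v; apply: etrans (linearP (mulmxr M) a _ _); congr (_ *m _).
  by apply/rowP=> i; rewrite !mxE mulrDl mulrA.
by apply/rowP=> i; rewrite !mxE mulrDr mulrCA.
Qed.
HB.instance Definition _ := bilinear_isBilinear.Build K A A A
  *:%R *:%R evo_mul evo_mul_bilinear.
HB.instance Definition _ := hasAlgMul.Build K A evo_mul.

Definition evo_std : n.-tuple A := [tuple (delta_mx 0 i : A) | i < n].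

Lemma evo_stdP : natural_basis evo_std /\ structure_mx evo_std = M.
Proof.
have stdE i : tnth evo_std i = delta_mx 0 i by rewrite tnth_mktuple.
have stdM i j : tnth evo_std i ** tnth evo_std j = (i == j)%:R *: row i M.
  rewrite !stdE; change (evo_mul (delta_mx 0 i) (delta_mx 0 j) = (i == j)%:R *: row i M).
  rewrite /evo_mul rowE scalemxAl; congr (_ *m _).
  apply/rowP=> k; rewrite !mxE eqxx /= [i == j]eq_sym.
  by case: (eqVneq k i) => [->|_]; rewrite ?mulr1 ?mulr0 ?mul0r ?mul1r // eq_sym.
have stdsum (u : 'rV[K]_n) : (u : A) = \sum_i u 0 i *: evo_std`_i.
  rewrite {1}(row_sum_delta u); apply: eq_bigr => i _.
  by rewrite -tnth_nth stdE.
have stdb : basis_of fullv evo_std.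
  rewrite basisEdim dimvf size_tuple /dim /= mul1n leqnn andbT.
  apply/subvP=> u _; rewrite [u]stdsum rpred_sum // => i _.
  by rewrite rpredZ // memv_span // mem_nth ?size_tuple.
split; first by split=> // i j /negPf neq_ij; rewrite stdM neq_ij scale0r.
apply/matrixP=> i k; rewrite !mxE stdM eqxx scale1r [row i M]stdsum.
by rewrite coord_sum_free ?(basis_free stdb) // mxE.
Qed.

End EvoAlg.

Section Families.
Variable K : fieldType.

Lemma structure_mxP (E : naAlgType K) n (B : n.-tuple E) i : basis_of fullv B ->
  tnth B i ** tnth B i = \sum_k structure_mx B i k *: tnth B k.
Proof.
move=> bB; rewrite {1}(coord_basis bB (memvf (tnth B i ** tnth B i))).
by apply: eq_bigr => k _; rewrite mxE (tnth_nth 0 B k).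
Qed.

(* The structure matrix of E_k(lam_1, ..., lam_s). *)
Definition Ek_mx s (k : nat) (lam : 'I_s -> K) : 'M[K]_s :=
  \matrix_(i, j) (if (j < k)%N then lam i else 0).

Definition Ek_params s k (lam : 'I_s -> K) :=
  [/\ (1 <= k <= s)%N, exists i, lam i != 0 & \sum_(j < s | (j < k)%N) lam j = 0].

(* B exhibits E as an algebra E_k(lam_1, ..., lam_s). *)
Definition Ek_basis (E : naAlgType K) s k (lam : 'I_s -> K) (B : s.-tuple E) :=
  [/\ Ek_params k lam, natural_basis B & structure_mx B = Ek_mx k lam].

Definition Ek_alg s k (lam : 'I_s -> K) := evo_alg (Ek_mx k lam).

Definition E2_1N1 := Ek_alg 2 (fun i : 'I_2 => (-1) ^+ i : K).

Definition strictly_lower n (L : 'M[K]_n) := forall i j : 'I_n, (i <= j)%N -> L i j = 0.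

(* E belongs to the family F(E_1, ..., E_r), the inclusion of the natural basis
   B_i of E_i in that of E being given by f_i : E_i -> E. *)
Definition family_embedding r (Es : 'I_r -> naAlgType K) (s : 'I_r -> nat)
    (Bs : forall i, (s i).-tuple (Es i)) (E : naAlgType K)
    (f : forall i, 'Hom(Es i, E)) :=
  exists q (B : (\sum_i s i + q).-tuple E), [/\ natural_basis B,
    forall i j, f i (tnth (Bs i) j) = tnth B (lshift q (tagnat.Rank i j)) &
    exists C L, strictly_lower L /\
      structure_mx B = block_mx (\mxdiag_(i < r) structure_mx (Bs i)) 0 C L].

(* Hence E / E_i^2 is a genuine quotient algebra. *)
Lemma family_square_ideal r (Es : 'I_r -> naAlgType K) (s : 'I_r -> nat)
    (Bs : forall i, (s i).-tuple (Es i)) (E : naAlgType K)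
    (f : forall i, 'Hom(Es i, E)) :
  (forall i, natural_basis (Bs i)) -> family_embedding Bs f ->
  forall i, ideal (f i @: alg_square (Es i))%VS.
Proof.
move=> natBs [q [B [[bB B0] fB [C [L [_ SB]]]]]] i.
have fsq j : f i (tnth (Bs i) j ** tnth (Bs i) j) = f i (tnth (Bs i) j) ** f i (tnth (Bs i) j).
  rewrite fB !structure_mxP ?(natBs _).1 // SB big_split_ord /=.
  rewrite [X in _ + X]big1 ?addr0 => [|k _]; last by rewrite block_mxEur mxE scale0r.
  rewrite (reindex _ (onW_bij _ (@tagnat.rank_bij _ s))) /=.
  pose S0 := \mxdiag_(a < r) structure_mx (Bs a).
  transitivity (\sum_a \sum_k S0 (tagnat.Rank i j) (@tagnat.Rank _ s a k) *:
                 tnth B (lshift q (tagnat.Rank a k))); last first.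
    by rewrite sig_big_dep /=; apply: eq_bigr => p _; rewrite block_mxEul tagnat.rankE.
  have S0E a k : S0 (tagnat.Rank i j) (tagnat.Rank a k) = submxblock S0 i a j k.
    by rewrite [RHS]mxE.
  rewrite (bigD1 i) //= [X in _ + X]big1 ?addr0 => [|a ai].
    rewrite linear_sum; apply: eq_bigr => k _.
    by rewrite linearZ /= fB S0E submxblock_diag.
  apply: big1 => k _; rewrite S0E /S0 /mxdiag mxblockK eq_sym (negPf ai) mxE scale0r //.
have mulf a y : tnth B a ** f i y \in (f i @: alg_square (Es i))%VS
  /\ f i y ** tnth B a \in (f i @: alg_square (Es i))%VS.
  rewrite (coord_basis (natBs i).1 (memvf y)) !linear_sum linear_sumlz.
  have main k : let z := coord (Bs i) k y *: (Bs i)`_k in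
       tnth B a ** f i z \in (f i @: alg_square (Es i))%VS
    /\ f i z ** tnth B a \in (f i @: alg_square (Es i))%VS.
    rewrite /= linearZ /= linearZr_LR linearZl_LR -(tnth_nth 0 _ k) fB.
    have [->|neq] := eqVneq a (lshift q (tagnat.Rank i k)).
      by rewrite -fB -fsq; split; apply/rpredZ/memv_img/mem_prods; rewrite memvf.
    by rewrite !B0 ?scaler0 ?rpred0 // eq_sym.
  by split; apply: rpred_sum => k _; have [] := main k.
apply/andP; split; apply/prodsP => x y.
  case/memv_imgP=> u _ -> _; rewrite (coord_basis bB (memvf y)) linear_sumr.
  apply: rpred_sum => k _; rewrite linearZr_LR rpredZ // -(tnth_nth 0).
  by have [] := mulf k u.
move=> _ /memv_imgP[u _ ->]; rewrite (coord_basis bB (memvf x)) linear_sumlz.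
apply: rpred_sum => k _; rewrite linearZl_LR rpredZ // -(tnth_nth 0).
by have [] := mulf k u.
Qed.

End Families.

(* Main.v *)
Require Import Defs.
From HB Require Import structures.
From mathcomp Require Import all_boot all_order all_algebra.
From mathcomp Require Import zify.

(* Everything is equivalent to dim E^2 = n - 1.

   Each E_i contains a hyperbolic pair: u = e_1 + ... + e_k spans E_i^2, u^2 = 0, and
   some v satisfies v^2 = 0, uv = u. If w is such that wu, wv, w^2 lie in <u> and w is
   not in <u, v>, then <u, v, w> contains two square-zero elements whose product spans <u>
   and which generate a three-dimensional subalgebra, so E is not modular. Hence a
   modular E has r = 1 and E_1 = <u, v>; and, square roots being available, if some
   f_j^2 lay in the square of D = <u, v, f_1, ..., f_(j-1)>, then f_j + y for a suitable y in D
   would be such a w. So the squares of the flag D_k = <first k of u, v, f_1, f_2, ...>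
   satisfy (D_(k+1))^2 = D_k. The same follows from dim E^2 = n - 1, because the
   squares of the natural basis span at most r + (n - sum of the dim E_i) dimensions.

   Conversely, when (D_(k+1))^2 = D_k the D_(n-k+1) form the derived series, and the
   subalgebras of E are exactly the D_k and the D_k meet {x | vx = 0} with k >= 1, so that
   the lattice is distributive. For the nilpotency index, E^k is contained in the (t+1)-st
   iterate of I |-> I E for k > 2^t and contains E^(t+1) for k = 2^t, so the maximum in
   dimension m is 2^(m-1) + 1, and it is reached only if dim E^2 = m - 1. *)

Set Implicit Arguments.
Unset Strict Implicit.
Unset Printing Implicit Defensive.

Import GRing.Theory.
Local Open Scope ring_scope.

(** * Products, powers and nilpotency indices *)

Definition commutative_alg (K : fieldType) (E : naAlgType K) :=
  forall x y : E, x ** y = y ** x.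

Section Products.
Variables (K : fieldType) (E : naAlgType K).
Implicit Types (U V W : {vspace E}) (x y z : E) (a b : K).

Lemma amulDl x y z : (x + y) ** z = x ** z + y ** z.
Proof. exact: linearDl. Qed.
Lemma amulDr z x y : z ** (x + y) = z ** x + z ** y.
Proof. exact: linearDr. Qed.
Lemma amulZl a x z : (a *: x) ** z = a *: (x ** z).
Proof. exact: linearZl_LR. Qed.
Lemma amulZr a z x : z ** (a *: x) = a *: (z ** x).
Proof. exact: linearZr_LR. Qed.
Lemma amul0l z : 0 ** z = 0.
Proof. exact: linear0l. Qed.
Lemma amul0r z : z ** 0 = 0.
Proof. exact: linear0r. Qed.
Lemma amulNl x z : (- x) ** z = - (x ** z).
Proof. exact: linearNl. Qed.
Lemma amulNr z x : z ** (- x) = - (z ** x).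
Proof. exact: linearNr. Qed.

Definition amulE := (amulDl, amulDr, amulZl, amulZr, amul0l, amul0r, amulNl, amulNr).

Lemma prodsS U U' V V' : (U <= U')%VS -> (V <= V')%VS -> (prods U V <= prods U' V')%VS.
Proof.
move=> sU sV; apply/prodsP => x y xU yV.
by apply: mem_prods; [apply: (subvP sU) | apply: (subvP sV)].
Qed.

Lemma prods0l V : prods 0 V = 0%VS.
Proof.
apply/eqP; rewrite -subv0; apply/prodsP=> x y.
by rewrite memv0 => /eqP-> _; rewrite amul0l mem0v.
Qed.

Lemma prodsDl U V W : prods (U + V) W = (prods U W + prods V W)%VS.
Proof.
apply/eqP; rewrite eqEsubv subv_add !prodsS ?addvSl ?addvSr // !andbT.
apply/prodsP=> _ y /memv_addP[a aU [b bV ->]] yW.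
by rewrite amulDl memv_add // mem_prods.
Qed.

Lemma prodsDr U V W : prods W (U + V) = (prods W U + prods W V)%VS.
Proof.
apply/eqP; rewrite eqEsubv subv_add !prodsS ?addvSl ?addvSr // !andbT.
apply/prodsP=> y _ yW /memv_addP[a aU [b bV ->]].
by rewrite amulDr memv_add // mem_prods.
Qed.

Lemma prods_line x y : prods <[x]> <[y]> = <[x ** y]>%VS.
Proof.
apply/eqP; rewrite eqEsubv; apply/andP; split.
  apply/prodsP=> _ _ /vlineP[a ->] /vlineP[b ->].
  by rewrite !amulE !memvZ ?memv_line.
by rewrite -memvE mem_prods ?memv_line.
Qed.

Lemma prodsC U V : commutative_alg E -> prods U V = prods V U.
Proof.
by move=> EC; apply/eqP; rewrite eqEsubv; apply/andP; split; apply/prodsP=> x y xU yV;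
  rewrite EC mem_prods.
Qed.

Lemma prods_eq0 U V :
  (forall x y, x \in U -> y \in V -> x ** y = 0) -> prods U V = 0%VS.
Proof.
by move=> UV0; apply/eqP; rewrite -subv0; apply/prodsP=> x y xU yV; rewrite UV0 ?mem0v.
Qed.

Lemma amul_span0 x (X : seq E) : {in X, forall y, x ** y = 0} ->
  {in <<X>>%VS, forall y, x ** y = 0}.
Proof.
move=> X0 y yX; have: (<<X>> <= lker (linfun (almul x)))%VS.
  by apply/span_subvP=> z /X0 xz; rewrite memv_ker lfunE /= xz.
by move/subvP/(_ y yX); rewrite memv_ker lfunE => /eqP.
Qed.

Lemma natural_basis_mulE n (B : n.-tuple E) x y : natural_basis B ->
  x ** y = \sum_i (coord B i x * coord B i y) *: (tnth B i ** tnth B i).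
Proof.
case=> bB B0; rewrite {1}(coord_basis bB (memvf x)) {1}(coord_basis bB (memvf y)).
rewrite linear_sumlz; apply: eq_bigr => i _; rewrite linear_sumr (bigD1 i) //= big1.
  by rewrite addr0 !amulE scalerA -!(tnth_nth 0).
by move=> j ji; rewrite !amulE -!(tnth_nth 0) B0 ?scaler0 // eq_sym.
Qed.

Lemma natural_basis_comm n (B : n.-tuple E) : natural_basis B -> commutative_alg E.
Proof.
move=> bB x y; rewrite !(natural_basis_mulE _ _ bB).
by apply: eq_bigr => i _; rewrite mulrC.
Qed.

Lemma evolution_comm : evolution E -> commutative_alg E.
Proof. by case=> n [B /natural_basis_comm]. Qed.

End Products.

Lemma vline0 (K : fieldType) (V : vectType K) : <[0 : V]>%VS = 0%VS.
Proof. by apply/eqP; rewrite -dimv_eq0 dim_vline eqxx. Qed.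

Lemma span_take (K : fieldType) (V : vectType K) (X : seq V) k : (k < size X)%N ->
  (<<take k.+1 X>> = <<take k X>> + <[X`_k]>)%VS.
Proof. by move=> kX; rewrite (take_nth 0 kX) -cats1 span_cat span_seq1. Qed.

(** A descending orbit that repeats a value is constant from there on. As the orbit reaches 0, it
    loses at least one dimension at every step until then. *)
Lemma dim_iter_leq (K : fieldType) (V : vectType K) (phi : {vspace V} -> {vspace V}) U T :
    (forall t, (iter t.+1 phi U <= iter t phi U)%VS) -> iter T phi U = 0%VS ->
  forall t, (\dim (iter t phi U) <= \dim U - t)%N.
Proof.
move=> dec zT; elim=> [|t IHt]; first by rewrite subn0.
have [eqt|ltt] := eqVneq (iter t.+1 phi U) (iter t phi U).
  have stat j : iter (j + t) phi U = iter t phi U by elim: j => // j IHj; rewrite addSn iterS IHj.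
  have zS j : iter (j + T) phi U = 0%VS.
    elim: j => // j IHj; apply/eqP; rewrite -subv0 -IHj; exact: dec.
  by rewrite eqt -(stat T) addnC zS dimv0.
suff: (\dim (iter t.+1 phi U) < \dim (iter t phi U))%N by lia.
rewrite ltn_neqAle dimvS ?dec // andbT; apply: contra ltt => eqd.
by rewrite eqEdim dec (eqP eqd) leqnn.
Qed.

Section Morphism.
Variables (K : fieldType) (E F : naAlgType K) (f : 'Hom(E, F)).
Hypothesis fM : {morph f : x y / x ** y}.

Lemma limg_prods U V : (f @: prods U V = prods (f @: U) (f @: V))%VS.
Proof.
apply/eqP; rewrite eqEsubv; apply/andP; split.
  apply/subvP=> _ /memv_imgP[x xUV ->].
  have: (prods U V <= f @^-1: prods (f @: U) (f @: V))%VS.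
    by apply/prodsP=> a b aU bV; rewrite -memv_preim fM mem_prods ?memv_img.
  by move/subvP/(_ x xUV); rewrite -memv_preim.
apply/prodsP=> _ _ /memv_imgP[x xU ->] /memv_imgP[y yV ->].
by rewrite -fM memv_img ?mem_prods.
Qed.

Lemma limg_iter_spow k : limg f = fullv -> (f @: spow E k = spow F k)%VS.
Proof.
by move=> fT; rewrite /spow; elim: k.-1 => //= t IHt; rewrite limg_prods IHt.
Qed.

End Morphism.

Section Nilpotency.
Variables (K : fieldType) (E : naAlgType K).
Implicit Types (U V W : {vspace E}).

(** The right principal powers, with the index shifted by one: [right_pow 0] is the whole
    algebra. *)
Definition right_pow t : {vspace E} := iter t (fun I => prods I fullv) fullv.

Lemma right_powS t : right_pow t.+1 = prods (right_pow t) fullv. Proof. by []. Qed.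

Lemma right_pow_dec t : (right_pow t.+1 <= right_pow t)%VS.
Proof. by elim: t => [|t IHt]; [apply: subvf | rewrite !right_powS prodsS]. Qed.

Lemma spowS k : (0 < k)%N -> spow E k.+1 = prods (spow E k) (spow E k).
Proof. by case: k. Qed.

Lemma spow_dec t : (iter t.+1 (fun U : {vspace E} => prods U U) fullv
  <= iter t (fun U : {vspace E} => prods U U) fullv)%VS.
Proof. by elim: t => [|t IHt]; [apply: subvf | rewrite 2!iterS prodsS]. Qed.

Lemma npowM a b : (0 < a)%N -> (0 < b)%N ->
  (prods (npow E a) (npow E b) <= npow E (a + b))%VS.
Proof.
case: a => // a _ b_gt0; rewrite addSn (@npowS _ _ (a + b)); last by lia.
rewrite (big_cat_nat (n := a.+1)) /=; [|lia|lia].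
rewrite [X in (_ + X)%VS]big_ltn; last by lia.
apply: subv_trans (addvSr _ _); apply: subv_trans (addvSl _ _).
by have ->: ((a + b).+1 - a.+1 = b)%N by lia.
Qed.

Lemma npow_sub k W : (0 < k)%N ->
  (forall i, (0 < i <= k)%N -> (prods (npow E i) (npow E (k.+1 - i)) <= W)%VS) ->
  (npow E k.+1 <= W)%VS.
Proof.
move=> k_gt0 sW; rewrite npowS // big_nat_cond.
elim/big_ind: _ => [||i /andP[/andP[i1 i2] _]]; first exact: sub0v.
  by move=> U V sU sV; rewrite subv_add sU.
by apply: sW; rewrite i1.
Qed.

Lemma npow_dec k : (0 < k)%N -> (npow E k.+1 <= npow E k)%VS.
Proof.
elim/ltn_ind: k => k IHk k_gt0; apply: npow_sub => // i /andP[i_gt0 i_le].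
have [k1|k_neq1] := eqVneq k 1%N; first by rewrite k1 npow1 subvf.
have [i1|i_neq1] := eqVneq i 1%N.
  rewrite i1 subn1 /=; case: k => [//|k] in IHk k_gt0 i_le k_neq1 *.
  apply: subv_trans (npowM (a := 1) _ _); rewrite ?prodsS //; last by lia.
  by apply: IHk; lia.
case: i => // i in i_gt0 i_le i_neq1 *.
have {2}-> : (k = i + (k.+1 - i.+1))%N by lia.
apply: subv_trans (npowM _ _); rewrite ?prodsS //; try lia.
by apply: IHk; lia.
Qed.

Lemma npowS_leq j k : (0 < j)%N -> (j <= k)%N -> (npow E k <= npow E j)%VS.
Proof.
move=> j_gt0 /subnK <-; elim: (k - j)%N => // d IHd; rewrite addSn.
by apply: subv_trans IHd; apply: npow_dec; lia.
Qed.

Lemma spow_npow t : (spow E t.+1 <= npow E (2 ^ t))%VS.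
Proof.
elim: t => [|t IHt]; first by rewrite npow1.
rewrite spowS // expnS mul2n -addnn.
by apply: subv_trans (npowM _ _); rewrite ?prodsS ?expn_gt0.
Qed.

Lemma right_pow_npow t : (right_pow t <= npow E t.+1)%VS.
Proof.
elim: t => [|t IHt]; first by rewrite npow1.
rewrite right_powS -[X in npow E X]addn1.
by apply: subv_trans (npowM _ _); rewrite ?prodsS.
Qed.

Hypothesis EC : commutative_alg E.

(** In a product E^i E^j with i + j > 2^(t+1), one index exceeds 2^t. Commutativity puts that factor
    on the left, and induction places it in [right_pow t.+1]. *)
Lemma npow_right_pow t k : (2 ^ t < k)%N -> (npow E k <= right_pow t.+1)%VS.
Proof.
elim: t k => [|t IHt] [//|k]; rewrite ltnS => lt_k.
  by apply: npow_sub => // i _; rewrite prodsS ?subvf.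
rewrite expnS mul2n -addnn in lt_k.
have k_gt0 : (0 < k)%N by move: (expn_gt0 2 t); lia.
apply: npow_sub => // i /andP[i1 i2].
have [lt_i|le_i] := ltnP (2 ^ t) i; first by rewrite right_powS prodsS ?IHt ?subvf.
by rewrite prodsC // right_powS prodsS ?subvf ?IHt //; lia.
Qed.

Lemma nilpotent_right_pow : nilpotent_alg E ->
  forall t, (\dim (right_pow t) <= \dim {: E} - t)%N.
Proof.
case=> k k_gt0 Ek0; apply: (dim_iter_leq (T := k.-1)); first exact: right_pow_dec.
by apply/eqP; rewrite -subv0 -Ek0 -[in X in npow _ X](prednK k_gt0) right_pow_npow.
Qed.

Lemma nilpotency_index_leq k : (0 < \dim {: E})%N -> nilpotency_index E k ->
  (k <= (2 ^ (\dim {: E}).-1).+1)%N.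
Proof.
move=> E_gt0 [k_gt0 Ek0 kmin]; rewrite leqNgt; apply/negP=> lt_k.
have /eqP[] := kmin (2 ^ (\dim {: E}).-1).+1 lt_k.
apply/eqP; rewrite -subv0; apply: subv_trans (npow_right_pow (leqnn _)) _.
rewrite prednK // subv0 -dimv_eq0 -leqn0.
have := nilpotent_right_pow (ex_intro2 _ _ k k_gt0 Ek0) (\dim {: E}).
by rewrite subnn.
Qed.

(** The powers are bounded above by the right powers and below by the derived series. Both estimates
    switch at 2^(m-1), so together they determine the index exactly. *)
Lemma nilpotency_index_pow2 m : (0 < m)%N -> right_pow m = 0%VS -> spow E m != 0%VS ->
  nilpotency_index E (2 ^ m.-1).+1.
Proof.
move=> m_gt0 I0 S0; split=> // [|j /andP[j_gt0 j_le]].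
  apply/eqP; rewrite -subv0 -I0 -[X in right_pow X](prednK m_gt0).
  exact: npow_right_pow.
apply: contraNneq S0 => Ej0; rewrite -subv0 -Ej0 -(prednK m_gt0).
exact: subv_trans (spow_npow _) (npowS_leq j_gt0 j_le).
Qed.

(** The non-zero power of exponent 2^(m+1), where the dimension is m + 2, forces [right_pow m.+1] to
    be non-zero. This is m steps below E^2, and each step costs a dimension, so E^2 has dimension at
    least m + 1. *)
Lemma nilpotency_index_square k : nilpotency_index E k ->
  ((2 ^ (\dim {: E}).-1).+1 <= k)%N -> ((\dim {: E}).-1 <= \dim (alg_square E))%N.
Proof.
case=> k_gt0 Ek0 kmin lek; case Em: (\dim {: E}) lek => [//|[//|m]] /= lek.
have /eqP N0 := kmin (2 ^ m.+1)%N ltac:(rewrite expn_gt0 /=; lia).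
have I0 : right_pow m.+1 != 0%VS.
  apply/eqP=> I0; apply: N0; apply/eqP; rewrite -subv0 -I0; apply: npow_right_pow.
  by rewrite ltn_exp2l.
have : (\dim (right_pow m.+1) <= \dim (alg_square E) - m)%N.
  rewrite /right_pow iterSr -/(alg_square E).
  apply: (dim_iter_leq (T := k.-1)) => [t|].
    by have := right_pow_dec t.+1; rewrite /right_pow !iterSr.
  have -> : iter k.-1 (fun I => prods I fullv) (alg_square E) = right_pow k.
    by rewrite -[in RHS](prednK k_gt0) /right_pow iterSr.
  apply/eqP; rewrite -subv0 -Ek0; apply: subv_trans (right_pow_npow _) _.
  exact: npow_dec.
by rewrite -dimv_eq0 in I0; lia.
Qed.

End Nilpotency.

(** * The lattice of subalgebras *)

Section SubalgebraLattice.
Variables (K : fieldType) (E : naAlgType K).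
Implicit Types U V W : {vspace E}.

Lemma subalgebra0 : subalgebra (0%VS : {vspace E}).
Proof. by rewrite /subalgebra prods0l. Qed.

Lemma subalgebraI U V : subalgebra U -> subalgebra V -> subalgebra (U :&: V)%VS.
Proof.
move=> sU sV; rewrite /subalgebra subv_cap.
by rewrite (subv_trans (prodsS (capvSl U V) (capvSl U V)) sU)
  (subv_trans (prodsS (capvSr U V) (capvSr U V)) sV).
Qed.

Lemma subalgebra_aljoin U V : subalgebra (aljoin U V).
Proof. exact: algen_subalgebra. Qed.

Lemma sub_aljoinl U V : (U <= aljoin U V)%VS.
Proof. exact: subv_trans (addvSl U V) (sub_algen _). Qed.

Lemma sub_aljoinr U V : (V <= aljoin U V)%VS.
Proof. exact: subv_trans (addvSr U V) (sub_algen _). Qed.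

Lemma aljoin_min U V W : subalgebra W -> (U <= W)%VS -> (V <= W)%VS -> (aljoin U V <= W)%VS.
Proof. by move=> sW UW VW; rewrite algenP // subv_add UW. Qed.

Lemma aljoin_subl U V : subalgebra U -> (V <= U)%VS -> aljoin U V = U.
Proof.
by move=> sU VU; apply/eqP; rewrite eqEsubv sub_aljoinl aljoin_min ?subvv.
Qed.

Lemma aljoin_subr U V : subalgebra V -> (U <= V)%VS -> aljoin U V = V.
Proof.
by move=> sV UV; apply/eqP; rewrite eqEsubv sub_aljoinr aljoin_min ?subvv.
Qed.

Lemma aljoinS U V W : (V <= W)%VS -> (aljoin U V <= aljoin U W)%VS.
Proof.
move=> VW; apply: aljoin_min (subalgebra_aljoin _ _) (sub_aljoinl _ _) _.
exact: subv_trans VW (sub_aljoinr _ _).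
Qed.

Lemma distributive_modular : distributive_alg E -> modular_alg E.
Proof. by move=> dE U V W sU sV sW UW; rewrite dE // (aljoin_subr sW UW). Qed.

(** For W between U and the join, the modular law gives W as the join of U with V ∩ W, and V ∩ W
    lies between U ∩ V and V, where maximality leaves two choices. *)
Lemma modular_upper_semimodular : modular_alg E -> upper_semimodular_alg E.
Proof.
move=> mE U V sU sV [_ _ neqV maxV]; split=> //.
- exact: sub_aljoinl.
- apply: contra neqV => /eqP UJ; apply/eqP/capv_idPr.
  by rewrite UJ sub_aljoinr.
move=> W sW /andP[UW WJ].
case: (maxV (W :&: V)%VS) => [||WV|WV].
- exact: subalgebraI.
- by rewrite capvS // capvSr.
- left; rewrite -(capv_idPr WJ) -mE // capvC WV aljoin_subl //; exact: capvSl.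
- right; apply/eqP; rewrite eqEsubv WJ aljoin_min //.
  by rewrite -WV capvSl.
Qed.

Lemma subalgebra_nil_line (x : E) : x ** x = 0 -> subalgebra <[x]>%VS.
Proof. by move=> x2; rewrite /subalgebra prods_line x2 -memvE mem0v. Qed.

Hypothesis EC : commutative_alg E.

(* Otherwise [<x> < <u, x> < <x, y>] together with [<y>] spans a pentagon. *)
Lemma modular_nil_pair (u x y : E) a c : modular_alg E ->
  u ** u = 0 -> x ** x = 0 -> y ** y = 0 -> u ** x = a *: u -> x ** y = c *: u ->
  c != 0 -> u \notin <[x]>%VS -> y \in (<[u]> + <[x]>)%VS.
Proof.
move=> mE uu xx yy ux xy c0; apply: contraR => yW.
have sW : subalgebra (<[u]> + <[x]>)%VS.
  rewrite /subalgebra !(prodsDl, prodsDr) !prods_line uu xx [x ** u]EC ux !subv_add.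
  have uW : a *: u \in (<[u]> + <[x]>)%VS.
    by rewrite memvZ // (subvP (addvSl _ _)) ?memv_line.
  by rewrite -!memvE !mem0v uW.
have := mE <[x]>%VS <[y]>%VS (<[u]> + <[x]>)%VS (subalgebra_nil_line xx)
  (subalgebra_nil_line yy) sW (addvSr _ _).
have -> : (<[y]> :&: (<[u]> + <[x]>))%VS = 0%VS.
  apply/eqP; rewrite -subv0; apply/subvP=> z; rewrite memv_cap => /andP[/vlineP[t ->]].
  have [->|t0] := eqVneq t 0; first by rewrite scale0r !mem0v.
  by move=> /(memvZ t^-1); rewrite scalerA mulVf // scale1r (negPf yW).
rewrite (aljoin_subl (subalgebra_nil_line xx) (sub0v _)) => eqx.
rewrite eqx memv_cap (subvP (addvSl _ _)) ?memv_line // andbT.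
suff : c *: u \in aljoin <[x]> <[y]>.
  by move/(memvZ c^-1); rewrite scalerA mulVf // scale1r.
rewrite -xy; apply: (prodsP _ _ _ (subalgebra_aljoin _ _)).
  by rewrite (subvP (sub_aljoinl _ _)) ?memv_line.
by rewrite (subvP (sub_aljoinr _ _)) ?memv_line.
Qed.

(** Removing from [w] a combination of [u] and [v] leaves [z] killed by both, with
    [z ** z = d *: u]. From [z] one builds two square-zero elements with product a non-zero multiple
    of [u] and applies [modular_nil_pair]; the choice depends on whether d = 0. *)
Lemma modular_hyperbolic (u v w : E) a b c : modular_alg E -> 2%:R != 0 :> K ->
  u != 0 -> u ** u = 0 -> v ** v = 0 -> u ** v = u ->
  u ** w = a *: u -> v ** w = b *: u -> w ** w = c *: u -> w \in (<[u]> + <[v]>)%VS.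
Proof.
move=> mE two0 u0 uu vv uv uw vw ww.
pose z := w - (b *: u + a *: v).
have uz : u ** z = 0 by rewrite !amulE uw uu uv scaler0 add0r subrr.
have vz : v ** z = 0 by rewrite !amulE vw [v ** u]EC uv vv scaler0 addr0 subrr.
have [d zz] : exists d, z ** z = d *: u.
  exists (c - (b * a + a * b)).
  rewrite {1}/z amulDl amulNl amulDl !amulZl uz vz !scaler0 addr0 subr0.
  by rewrite !amulE ww [w ** u]EC uw [w ** v]EC vw !scalerA -scalerDl -scalerBl.
suff zuv : z \in (<[u]> + <[v]>)%VS.
  rewrite -[w](subrK (b *: u + a *: v)) rpredD // memv_add // memvZ ?memv_line //.
move: z uz vz zz => z uz vz zz.
have line_contra x : u ** x = u -> u \notin <[x]>%VS.
  move=> ux; apply/vlineP => -[t ut].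
  have : t *: u = 0 by rewrite -[in X in t *: X]ux -amulZr -ut.
  move/eqP; rewrite scaler_eq0 (negPf u0) orbF => /eqP t0.
  by case/eqP: u0; rewrite ut t0 scale0r.
(* Multiplication by [u] reads off the coefficient of [x]. *)
have uS x : u ** x = u -> forall y, y \in (<[u]> + <[x]>)%VS ->
    exists k, u ** y = k *: u /\ y - k *: x \in <[u]>%VS.
  move=> ux _ /memv_addP[_ /vlineP[k1 ->] [_ /vlineP[k ->] ->]].
  by exists k; rewrite !amulE uu ux scaler0 add0r addrK memvZ ?memv_line.
have [d0|d0] := eqVneq d 0.
  pose x := v + z; pose y := u + z.
  have ux : u ** x = u by rewrite amulDr uv uz addr0.
  have xx : x ** x = 0 by rewrite /x !amulE [z ** v]EC vv vz zz d0 scale0r !addr0.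
  have yy : y ** y = 0 by rewrite /y !amulE [z ** u]EC uu uz zz d0 scale0r !addr0.
  have xy : x ** y = 1 *: u.
    by rewrite /x /y !amulE [v ** u]EC [z ** u]EC uv vz uz zz d0 scale0r !addr0 scale1r.
  have := modular_nil_pair mE uu xx yy (etrans ux (esym (scale1r u))) xy
    (oner_neq0 K) (line_contra x ux).
  case/(uS x ux) => k []; rewrite !amulE uu uz addr0 => /esym/eqP.
  rewrite scaler_eq0 (negPf u0) orbF => /eqP ->; rewrite scale0r subr0 => yu.
  rewrite -[z](addKr u) addrC; apply/(subvP (addvSl _ _)).
  by rewrite rpredB ?memv_line.
(* The correction by d/2 kills the square: [v ** x], [z ** x] and the last term contribute -d/2, d
   and -d/2 times [u]. *)
pose x := v + (z - (d / 2%:R) *: u).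
have ux : u ** x = u by rewrite !amulE uv uz uu scaler0 subr0 addr0.
have vx : v ** x = - ((d / 2%:R) *: u) by rewrite /x !amulE vv vz [v ** u]EC uv !add0r.
have zx : z ** x = d *: u.
  by rewrite /x !amulE [z ** v]EC vz zz [z ** u]EC uz scaler0 subr0 add0r.
have xx : x ** x = 0.
  rewrite {1}/x !(amulDl, amulNl, amulZl) ux vx zx addrCA -opprD -scalerDl.
  suff -> : d / 2%:R + d / 2%:R = d by rewrite subrr.
  by rewrite -[_ + _]mulr2n -[_ *+ 2]mulr_natr -mulrA mulVf // mulr1.
have xv : x ** v = (- (d / 2%:R)) *: u.
  by rewrite /x !amulE vv [z ** v]EC vz uv !add0r scaleNr.
have := modular_nil_pair mE uu xx vv (etrans ux (esym (scale1r u))) xv _ (line_contra x ux).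
rewrite oppr_eq0 mulf_neq0 ?invr_eq0 // => /(_ isT).
case/(uS x ux) => k []; rewrite uv => /eqP; rewrite -subr_eq0 -[X in X - _]scale1r -scalerBl.
rewrite scaler_eq0 (negPf u0) orbF subr_eq0 => /eqP <-; rewrite scale1r => vxu.
rewrite -[z](subrK ((d / 2%:R) *: u)) rpredD //.
  by rewrite -[z - _](addKr v) addrC -opprB rpredN (subvP (addvSl _ _)).
by rewrite (subvP (addvSl _ _)) // memvZ ?memv_line.
Qed.

End SubalgebraLattice.

(** * Flags *)

(** The first two natural vectors are replaced by a hyperbolic pair, so that every initial span of
    the basis is a subalgebra. In [flag_sq], [take i.+2] keeps exactly the basis vectors preceding
    the [i]-th entry of [fs]. *)
Record flag_basis (K : fieldType) (E : naAlgType K) (u v : E) (fs : seq E) : Prop := FlagBasis {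
  flag_basis_of : basis_of fullv (u :: v :: fs);
  flag_uu : u ** u = 0;
  flag_vv : v ** v = 0;
  flag_uv : u ** v = u;
  flag_uf : {in fs, forall y, u ** y = 0};
  flag_vf : {in fs, forall y, v ** y = 0};
  flag_ff : forall i j, (i < j < size fs)%N -> fs`_i ** fs`_j = 0;
  flag_sq : forall i, (i < size fs)%N -> fs`_i ** fs`_i \in <<take i.+2 (u :: v :: fs)>>%VS }.

Section Flag.
Variables (K : fieldType) (E : naAlgType K) (u v : E) (fs : seq E).
Hypotheses (EC : commutative_alg E) (Eflag : flag_basis u v fs).

Local Notation g := (u :: v :: fs).
Local Notation n := (\dim {: E}).
Local Notation D k := (<<take k (u :: v :: fs)>>%VS : {vspace E}).

Lemma flag_size : n = (size fs).+2.
Proof. by have /andP[/eqP <- /eqP ->] := flag_basis_of Eflag. Qed.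

Lemma flag_predK : n.-1.+1 = n. Proof. by rewrite flag_size. Qed.

Lemma flagS k : (k < n)%N -> D k.+1 = (D k + <[g`_k]>)%VS.
Proof. by rewrite flag_size => lt_k; rewrite -span_take. Qed.

Lemma flag_leq k l : (k <= l)%N -> (D k <= D l)%VS.
Proof.
move=> lekl; apply/sub_span => x; rewrite -(subnKC lekl) takeD mem_cat => -> //.
Qed.

Lemma flag_dim k : (k <= n)%N -> \dim (D k) = k.
Proof.
move=> le_k; have fr : free (take k g).
  apply: (@catl_free _ _ (drop k g)); rewrite cat_take_drop.
  exact: basis_free (flag_basis_of Eflag).
by rewrite (eqnP fr) size_takel //; rewrite flag_size in le_k.
Qed.

Lemma flag_full : D n = fullv.
Proof. by rewrite take_oversize ?flag_size //; apply/span_basis/flag_basis_of. Qed.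

Lemma flag_nth_notin k : (k < n)%N -> g`_k \notin D k.
Proof.
move=> lt_k; apply/negP; rewrite memvE => /addv_idPl eqD.
by have := flag_dim lt_k; rewrite flagS // eqD flag_dim 1?ltnW //; lia.
Qed.

Lemma flag1 : D 1 = <[u]>%VS. Proof. by rewrite /= span_seq1. Qed.

Lemma flag2 : D 2 = (<[u]> + <[v]>)%VS.
Proof. by rewrite /= take0 span_cons span_seq1. Qed.

Lemma flag_u : u \in D 1. Proof. by rewrite flag1 memv_line. Qed.
Lemma flag_v : v \in D 2. Proof. by rewrite flag2 (subvP (addvSr _ _)) ?memv_line. Qed.

Lemma flag_u_neq0 : u != 0.
Proof.
have := @flag_dim 1; rewrite flag1 dim_vline flag_size => /(_ isT).
by case: (u != 0).
Qed.

(** The bound [1 < k] excludes [v], the only basis vector that is not orthogonal to the earlier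
    ones. *)
Lemma flag_mul0 k x : (1 < k < n)%N -> x \in D k -> g`_k ** x = 0.
Proof.
case: k => [|[|k]] // /andP[_]; rewrite flag_size /= !ltnS => lt_k.
apply: amul_span0 => y; rewrite /= !inE => /or3P[/eqP->|/eqP->|].
- by rewrite EC (flag_uf Eflag) ?mem_nth.
- by rewrite EC (flag_vf Eflag) ?mem_nth.
move=> /(nthP 0)[i]; rewrite (size_takel (ltnW lt_k)) => lt_i <-.
by rewrite nth_take // EC (flag_ff Eflag (i := i) (j := k)) ?lt_i.
Qed.

Lemma flag_sqS k : (1 < k < n)%N ->
  prods (D k.+1) (D k.+1) = (prods (D k) (D k) + <[g`_k ** g`_k]>)%VS.
Proof.
move=> Hk; have /andP[_ lt_k] := Hk.
have z : prods <[g`_k]> (D k) = 0%VS.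
  by apply: prods_eq0 => _ y /vlineP[a ->] yD; rewrite amulE flag_mul0 ?scaler0.
rewrite flagS // !(prodsDl, prodsDr) z prodsC // z prods_line add0v addv0 //.
Qed.

Lemma flag_sq1 : prods (D 1) (D 1) = 0%VS.
Proof. by rewrite flag1 prods_line (flag_uu Eflag) vline0. Qed.

Lemma flag_sq2 : prods (D 2) (D 2) = D 1.
Proof.
rewrite flag2 !(prodsDl, prodsDr) !prods_line (flag_uu Eflag) (flag_vv Eflag).
by rewrite [v ** u]EC (flag_uv Eflag) vline0 add0v addv0 addvv flag1.
Qed.

Lemma flag_sq_sub k : (k < n)%N -> (prods (D k.+1) (D k.+1) <= D k)%VS.
Proof.
case: k => [_|]; first by rewrite flag_sq1 sub0v.
elim=> [_|k IHk lt_k]; first by rewrite flag_sq2.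
rewrite flag_sqS ?lt_k // subv_add (subv_trans (IHk _)) ?flag_leq ?(ltnW lt_k) //.
by rewrite -memvE; apply: (flag_sq Eflag); rewrite flag_size in lt_k.
Qed.

(** Basis vectors beyond [D k.+1] annihilate it, so only its own square counts. The case k = 0 fails
    because [u ** v = u]. *)
Lemma flag_mulr_sub k : (0 < k < n)%N -> (prods (D k.+1) fullv <= D k)%VS.
Proof.
move=> /andP[k_gt0 lt_k]; rewrite -flag_full.
suff H d : (k.+1 + d <= n)%N -> (prods (D k.+1) (D (k.+1 + d)) <= D k)%VS.
  by rewrite -(subnKC lt_k) H // subnKC.
elim: d => [|d IHd] le_n; first by rewrite addn0 flag_sq_sub.
rewrite addnS in le_n *; rewrite (@flagS (k.+1 + d)) // prodsDr subv_add (IHd (ltnW le_n)) andTb.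
apply/prodsP => x _ xD /vlineP[a ->]; rewrite amulZr EC flag_mul0 ?scaler0 ?mem0v //.
  by rewrite le_n andbT; lia.
by apply: subvP xD; rewrite flag_leq ?leq_addr.
Qed.

Lemma flag_subalgebra k : subalgebra (D k).
Proof.
have [le_k|lt_k] := leqP n k.
  rewrite flag_size in le_k; rewrite take_oversize // (span_basis (flag_basis_of Eflag)).
  exact: subvf.
case: k lt_k => [|k] lt_k; first by rewrite span_nil subalgebra0.
exact: subv_trans (flag_sq_sub (ltnW lt_k)) (flag_leq _).
Qed.

Lemma flag_v_mul x : v ** x \in <[u]>%VS.
Proof.
rewrite -flag1; apply: (subvP (flag_mulr_sub (k := 1) _)); rewrite ?flag_size //.
by rewrite mem_prods ?memvf ?flag_v.
Qed.

(** * Flags in modular algebras over a quadratically closed field *)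

Section ModularFlag.
Hypotheses (two0 : 2%:R != 0 :> K) (K_sqclosed : forall a : K, exists b, b ^+ 2 = a).
Hypothesis mE : modular_alg E.

(** Modulo [u], the square of [D k.+2] is spanned by the squares of pairwise orthogonal entries of
    [fs]. Square roots of the coefficients gather a combination of these into the square of a single
    vector. *)
Lemma flag_root_mod k : (k <= size fs)%N -> forall x, x \in prods (D k.+2) (D k.+2) ->
  exists2 y, y \in <<take k fs>>%VS & x - y ** y \in <[u]>%VS.
Proof.
elim: k => [_ x|k IHk lt_k x].
  by rewrite flag_sq2 flag1 => xu; exists 0; rewrite ?mem0v // amul0l subr0.
rewrite flag_sqS; last by rewrite flag_size.
case/memv_addP=> x' /(IHk (ltnW lt_k))[y yf x'y] [_ /vlineP[c ->] ->].
have [b bc] := K_sqclosed c.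
exists (y + b *: fs`_k).
  by rewrite span_take // memv_add // memvZ ?memv_line.
have yk : fs`_k ** y = 0.
  apply: (@flag_mul0 k.+2 y); first by rewrite flag_size.
  by apply: subvP yf; apply: sub_span => z zf; rewrite /= !inE zf !orbT.
rewrite amulDl !amulDr !amulZl !amulZr [y ** fs`_k]EC yk !scaler0 !(add0r, addr0).
by rewrite scalerA -expr2 bc /= opprD addrACA subrr addr0.
Qed.

(* If [f^2] lay in [(D k)^2], square roots would give [y] in [D k] with [(f + y)^2] in [<u>]
   and [f + y] annihilating [u] and [v]. *)
Lemma modular_flag_sq k : (k < n)%N -> prods (D k.+1) (D k.+1) = D k.
Proof.
case: k => [_|]; first by rewrite flag_sq1 take0 span_nil.
elim=> [_|k IHk lt_k]; first exact: flag_sq2.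
apply/eqP; rewrite eqEdim flag_sq_sub // andTb flag_sqS ?lt_k // (IHk (ltnW lt_k)).
have lt_kf : (k < size fs)%N by rewrite flag_size in lt_k.
rewrite (flag_dim (ltnW lt_k)).
have [sqD|sqND] := boolP (g`_k.+2 ** g`_k.+2 \in D k.+1); last first.
  rewrite -[X in (X < _)%N](flag_dim (ltnW (ltnW lt_k))).
  rewrite ltn_neqAle dimvS ?addvSl // andbT; apply: contra sqND => /eqP eqd.
  by rewrite memvE; apply/addv_idPl/esym/eqP; rewrite eqEdim addvSl eqd leqnn.
move: sqD; rewrite -(IHk (ltnW lt_k)) -rpredN => /(flag_root_mod (ltnW lt_kf))[y yf fy].
have yD : y \in D k.+2 by apply: subvP yf; apply: sub_span => z zf; rewrite /= !inE zf !orbT.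
have mul0 x : {in fs, forall y, x ** y = 0} -> x ** y = 0.
  by move=> H; apply: amul_span0 yf => z /mem_take /H.
have fk : fs`_k \in fs by rewrite mem_nth.
pose w := g`_k.+2 + y.
have uw : u ** w = 0 *: u.
  by rewrite amulDr (flag_uf Eflag) // mul0 ?scale0r ?addr0 //; apply: flag_uf Eflag.
have vw : v ** w = 0 *: u.
  by rewrite amulDr (flag_vf Eflag) // mul0 ?scale0r ?addr0 //; apply: flag_vf Eflag.
have [c ww] : exists c, w ** w = c *: u.
  have gy : g`_k.+2 ** y = 0 by apply: flag_mul0 yD; rewrite lt_k.
  apply/vlineP; rewrite amulDl !amulDr [y ** g`_k.+2]EC gy addr0 add0r.
  by rewrite -rpredN opprD.
have := modular_hyperbolic EC mE two0 flag_u_neq0 (flag_uu Eflag) (flag_vv Eflag)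
  (flag_uv Eflag) uw vw ww.
rewrite -flag2 => wD; case/negP: (flag_nth_notin lt_k).
rewrite -[g`_k.+2](addrK y) -/w rpredB //; apply: subvP wD; exact: flag_leq.
Qed.

Lemma modular_flag_square : \dim (alg_square E) = n.-1.
Proof.
have n1 : (n.-1 < n)%N by rewrite flag_size.
have := modular_flag_sq n1; rewrite flag_predK flag_full /alg_square => ->.
exact/flag_dim/ltnW.
Qed.

End ModularFlag.

(** * Flags in algebras whose square has codimension one *)

Section MaximalSquare.
Hypothesis Esq : \dim (alg_square E) = n.-1.

(** Downward induction from the whole algebra, on d = n - k. Each new basis vector adds one square,
    hence at most one dimension; since E^2 has the full dimension n - 1, no smaller square of the
    flag can fall short. *)
Lemma flag_square k : (k < n)%N -> prods (D k.+1) (D k.+1) = D k.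
Proof.
move=> lt_k; rewrite -[k](subKn (ltnW lt_k)).
move: (n - k)%N (leq_subr k n) (subn_gt0 k n) => d; rewrite lt_k => le_d d_gt0.
elim: d d_gt0 le_d => // d IHd _ lt_d.
have [d0|d_gt0] := posnP d.
  have n1 : (n.-1 < n)%N by rewrite flag_size.
  rewrite d0 subn1; apply/eqP; rewrite eqEdim flag_sq_sub // (flag_dim (ltnW n1)).
  by rewrite flag_predK flag_full -/(alg_square E) Esq leqnn.
have := IHd d_gt0 (ltnW lt_d).
have ->: (n - d = (n - d.+1).+1)%N by rewrite subnSK.
case Em: (n - d.+1)%N => [|[|m]].
- by rewrite flag_sq1 take0 span_nil.
- by rewrite flag_sq2.
have lt_m : (m.+3 < n)%N by lia.
rewrite flag_sqS ?lt_m // => eqD; apply/eqP; rewrite eqEdim (flag_sq_sub (ltnW lt_m)) andTb.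
have dimD : \dim (prods (D m.+3) (D m.+3) + <[g`_m.+3 ** g`_m.+3]>) = m.+3.
  by rewrite eqD (flag_dim (ltnW lt_m)).
rewrite (flag_dim (ltnW (ltnW lt_m))) -ltnS -[X in (X <= _)%N]dimD -[X in (_ <= X)%N]addn1.
apply: leq_trans (dimv_add_leqif _ _).1 _; rewrite leq_add2l dim_vline.
exact: leq_b1.
Qed.

Lemma flag_spow k : (k < n)%N -> spow E k.+1 = D (n - k).
Proof.
elim: k => [|k IHk] lt_k; first by rewrite subn0 flag_full.
rewrite spowS // (IHk (ltnW lt_k)) -(subnSK (ltnW lt_k)).
by rewrite flag_square //; lia.
Qed.

Lemma flag_max_solvability : max_solvability_index E.
Proof.
have n_gt0 : (0 < n)%N by rewrite flag_size.
split=> // [|[//|j] /andP[_]].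
  rewrite -flag_predK spowS // flag_spow ?flag_predK // -{1 3}flag_predK subSnn.
  exact: flag_sq1.
rewrite ltnS => lt_j; rewrite flag_spow // -dimv_eq0 flag_dim ?leq_subr //.
by rewrite subn_eq0 -ltnNge.
Qed.

(** The square of the new basis vector must supply the dimension by which the square of the flag
    grows. This drives the descent in [flag_climb] and gives the non-zero first lower diagonal of
    the structure matrix. *)
Lemma flag_sq_notin k : (1 < k < n)%N -> g`_k ** g`_k \notin D k.-1.
Proof.
case: k => [|k] // /andP[k_gt0 lt_k]; rewrite ltnS in k_gt0; rewrite /= memvE.
apply/negP=> /addv_idPl eqD; have := flag_square lt_k.
rewrite flag_sqS; last by rewrite ltnS k_gt0.
rewrite (flag_square (ltnW lt_k)) eqD => /(congr1 (fun U => \dim U)).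
rewrite (flag_dim (ltnW lt_k)) (flag_dim (ltnW (ltnW lt_k))); lia.
Qed.

End MaximalSquare.
End Flag.

(** * Classification of the subalgebras and distributivity *)

Section FlagSubalgebras.
Variables (K : fieldType) (E : naAlgType K) (u v : E) (fs : seq E).
Hypotheses (EC : commutative_alg E) (Eflag : flag_basis u v fs).
Hypothesis Esq : \dim (alg_square E) = (\dim {: E}).-1.

Local Notation g := (u :: v :: fs).
Local Notation n := (\dim {: E}).
Local Notation D k := (<<take k (u :: v :: fs)>>%VS : {vspace E}).
Local Notation H := (lker (linfun (almul v)) : {vspace E}).

Let mem_H x : (x \in H) = (v ** x == 0).
Proof. by rewrite memv_ker lfunE. Qed.

Let v_mul_u : v ** u = u. Proof. by rewrite EC (flag_uv Eflag). Qed.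

(** Squaring descends the flag inside [S]: if x = y + c g_k with k > 1 and c non-zero, then y^2 lies
    in D_(k-1) and g_k^2 does not, so x^2 is in D_k but not in D_(k-1). Induction then captures D_k
    modulo [u], and x itself adds g_k. *)
Lemma flag_climb (S : {vspace E}) k x : subalgebra S -> (k < n)%N ->
  x \in S -> x \in D k.+1 -> x \notin D k -> (D k.+1 <= S + <[u]>)%VS.
Proof.
move=> /prodsP sS; elim: k x => [|k IHk] x lt_k xS; first by rewrite flag1 addvSr.
rewrite (flagS Eflag lt_k) => /memv_addP[y yD [_ /vlineP[c ->] xE]] xND.
have c0 : c != 0 by apply: contraNneq xND => c0; rewrite xE c0 scale0r addr0.
suff DS : (D k.+1 <= S + <[u]>)%VS.
  rewrite subv_add DS -memvE -[g`_k.+1](scalerK c0) memvZ //.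
  rewrite -[c *: _](addKr y) addrC -xE rpredB ?(subvP DS _ yD) //.
  by rewrite (subvP (addvSl _ _)).
case: k IHk lt_k yD xE xND => [|k] IHk lt_k yD xE xND; first by rewrite flag1 addvSr.
have gy : g`_k.+2 ** y = 0 by apply: (flag_mul0 EC Eflag) yD; rewrite lt_k.
have xx : x ** x = y ** y + c ^+ 2 *: (g`_k.+2 ** g`_k.+2).
  rewrite xE amulDl !amulDr !amulZl !amulZr [y ** g`_k.+2]EC gy !scaler0 addr0 add0r.
  by rewrite scalerA.
have yy : y ** y \in D k.+1.
  by rewrite -(flag_square EC Eflag Esq (ltnW lt_k)) mem_prods.
have gg : g`_k.+2 ** g`_k.+2 \in D k.+2.
  rewrite -(flag_square EC Eflag Esq lt_k) mem_prods // (flagS Eflag lt_k).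
    by rewrite (subvP (addvSr _ _)) ?memv_line.
  by rewrite (subvP (addvSr _ _)) ?memv_line.
apply: (IHk (x ** x)); rewrite ?(ltnW lt_k) ?sS // xx.
  by rewrite rpredD ?memvZ // (subvP (flag_leq _ _ _ (leqnSn _)) _ yy).
apply/negP=> xxD; have := flag_sq_notin EC Eflag Esq (k := k.+2).
rewrite lt_k => /(_ isT) /negP[].
have c20 : c ^+ 2 != 0 by rewrite expf_neq0.
rewrite -[_ ** _](scalerK c20) memvZ //.
by rewrite -[c ^+ 2 *: _](addKr (y ** y)) addrC rpredB.
Qed.

Lemma flag_add_u S : subalgebra S -> exists2 k, (0 < k <= n)%N & (S + <[u]>)%VS = D k.
Proof.
move=> sS; have exk : exists k, (S <= D k)%VS by exists n; rewrite (flag_full Eflag) subvf.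
have n_gt0 : (0 < n)%N by rewrite (flag_size Eflag).
(* Minimality of the flag member containing [S] provides an element of [S] outside the preceding
   member, where [flag_climb] starts. Index 0 means that [S] is zero and the sum is [D 1]. *)
case: (ex_minnP exk) => -[|k] SD minS.
  exists 1%N; rewrite ?n_gt0 //; rewrite flag1.
  by move: SD; rewrite take0 span_nil subv0 => /eqP->; rewrite add0v.
have le_k : (k < n)%N by apply: minS; rewrite (flag_full Eflag) subvf.
exists k.+1; rewrite ?le_k //.
apply/eqP; rewrite eqEsubv subv_add SD -(flag1 u v fs) flag_leq //=.
have /subvPn[x xS xND] : ~~ (S <= D k)%VS by apply/negP=> /minS; rewrite ltnn.
by rewrite span_seq1; apply: (flag_climb sS le_k xS (subvP SD _ xS) xND).
Qed.

(* A subalgebra [S] without [u] whose image modulo [u] contains [v] contains [v]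
   itself, since [(v + c u)^2 = 2 c u]; then [v S] is a subspace of [<u>] and of [S]. *)
Lemma flag_subalgebraE S : 2%:R != 0 :> K -> subalgebra S ->
  exists k (b : bool), (0 < k <= n)%N /\ S = (if b then D k else D k :&: H)%VS.
Proof.
move=> two0 sS; have [k Hk SuD] := flag_add_u sS; exists k, (u \in S); split=> //.
case: ifPn => uS; first by rewrite -SuD; apply/esym/addv_idPl; rewrite -memvE.
have mulS := prodsP _ _ _ sS; have u0 := flag_u_neq0 Eflag.
have u_free c : c *: u \in S -> c = 0.
  move=> cuS; apply: contraNeq uS => c0.
  by rewrite -[u](scalerK c0) memvZ.
have SD : (S <= D k)%VS by rewrite -SuD addvSl.
have SH : (S <= H)%VS.
  case: k Hk SuD SD => [//|[|k]] Hk SuD SD.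
    apply/subvP=> x xS; have := subvP SD x xS; rewrite flag1 => /vlineP[c xE].
    by have := u_free c; rewrite -xE => /(_ xS) c0; rewrite xE c0 scale0r mem0v.
  have : v \in D k.+2 by rewrite (subvP (flag_leq _ _ _ (_ : (2 <= k.+2)%N))) ?flag_v.
  rewrite -SuD => /memv_addP[w wS [_ /vlineP[c ->] vE]].
  have wE : w = v - c *: u by rewrite vE addrK.
  have := mulS _ _ wS wS.
  rewrite wE !amulE (flag_vv Eflag) v_mul_u (flag_uv Eflag) (flag_uu Eflag).
  rewrite !scaler0 !oppr0 ?scaler0 ?oppr0 !(addr0, add0r).
  rewrite -opprD -scalerDl rpredN => /u_free/eqP.
  rewrite -mulr2n -mulr_natr mulf_eq0 (negPf two0) orbF => /eqP c0.
  have vS : v \in S by rewrite -[v]subr0 -(scale0r u) -c0 -wE.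
  apply/subvP=> x xS; rewrite mem_H.
  have /vlineP[d vx] := flag_v_mul EC Eflag x.
  by have := mulS _ _ vS xS; rewrite vx => /u_free->; rewrite scale0r.
(* Conversely, for y + c u in [H] with y in [S], multiplication by [v] kills y and fixes [u], so c =
   0. *)
apply/eqP; rewrite eqEsubv subv_cap SD SH /=; apply/subvP=> x.
rewrite memv_cap -SuD => /andP[/memv_addP[y yS [_ /vlineP[c ->] ->]]].
have /subvP/(_ y yS) := SH; rewrite !mem_H amulDr => /eqP->; rewrite amulZr v_mul_u add0r.
by rewrite scaler_eq0 (negPf u0) orbF => /eqP->; rewrite scale0r addr0.
Qed.

(** The law is immediate when [V] and [W] are comparable. The members D_k form a chain and so do the
    D_k ∩ H, so up to exchanging [V] and [W] the remaining case is V = D_k, W = D_l ∩ H with k <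
    l. *)
Lemma flag_distributive : 2%:R != 0 :> K -> distributive_alg E.
Proof.
move=> two0 U V W sU sV sW; apply/eqP; rewrite eqEsubv subv_cap.
rewrite !aljoinS ?capvSl ?capvSr //=.
have [VW|nVW] := boolP (V <= W)%VS; first by rewrite (capv_idPl VW) capvSl.
have [WV|nWV] := boolP (W <= V)%VS; first by rewrite (capv_idPr WV) capvSr.
have DHS k l : (k <= l)%N -> (D k :&: H <= D l :&: H)%VS.
  by move=> /(flag_leq u v fs) le_kl; rewrite capvS.
have [j [b1 [Hj UE]]] := flag_subalgebraE two0 sU.
suff main k l W' V' : (0 < k < l)%N -> V' = D k -> W' = (D l :&: H)%VS -> subalgebra W' ->
    (aljoin U V' :&: aljoin U W' <= aljoin U (V' :&: W'))%VS.
  have [k [b2 [Hk VE]]] := flag_subalgebraE two0 sV.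
  have [l [b3 [Hl WE]]] := flag_subalgebraE two0 sW.
  have [le_kl|lt_lk] := leqP k l; last have le_lk := ltnW lt_lk.
    case: b2 b3 VE WE => [] [] VE WE.
    - by rewrite VE WE flag_leq in nVW.
    - have [eq_kl|neq_kl] := eqVneq k l; first by rewrite VE WE eq_kl capvSl in nWV.
      apply: (main k l) => //; case/andP: Hk => -> _ /=; rewrite ltn_neqAle neq_kl //.
    - by rewrite VE WE (subv_trans (capvSl _ _)) ?flag_leq in nVW.
    - by rewrite VE WE DHS in nVW.
  case: b2 b3 VE WE => [] [] VE WE.
  - by rewrite VE WE flag_leq in nWV.
  - by rewrite VE WE (subv_trans (capvSl _ _)) ?flag_leq in nWV.
  - by rewrite capvC [(V :&: W)%VS]capvC; apply: (main l k) => //; case/andP: Hl => -> _.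
  - by rewrite VE WE DHS in nWV.
move=> /andP[k_gt0 lt_kl] VE WE sW'.
have sV' : subalgebra V' by rewrite VE (flag_subalgebra EC Eflag).
(* If U = D_j then [u] lies in [U], and each x in [V'] differs by a multiple of [u] from an element
   of D_k ∩ H, which is the meet of [V'] and [W']. *)
case: b1 UE => UE.
  apply: subv_trans (capvSl _ _) _; apply: aljoin_min (subalgebra_aljoin _ _) (sub_aljoinl _ _) _.
  apply/subvP=> x xV; have /vlineP[c vx] := flag_v_mul EC Eflag x.
  have uD i : (0 < i)%N -> u \in D i.
    by move=> i_gt0; rewrite (subvP (flag_leq _ _ _ i_gt0)) ?flag_u.
  rewrite -[x](subrK (c *: u)) rpredD //.
    rewrite (subvP (sub_aljoinr _ _)) // VE WE capvA (capv_idPl (flag_leq _ _ _ (ltnW lt_kl))).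
    rewrite memv_cap mem_H amulDr amulNr amulZr v_mul_u vx subrr eqxx andbT.
    by rewrite rpredB -?VE ?memvZ // VE uD.
  by rewrite memvZ // (subvP (sub_aljoinl _ _)) // UE uD //; case/andP: Hj.
have [le_jk|lt_kj] := leqP j k.
  have UV : (U <= V')%VS by rewrite UE VE (subv_trans (capvSl _ _)) ?flag_leq.
  have UW : (U <= W')%VS by rewrite UE WE DHS // (leq_trans le_jk) // ltnW.
  by rewrite (aljoin_subr sV' UV) (aljoin_subr sW' UW) sub_aljoinr.
(* Now U = D_j ∩ H with j > k. The join with [V'] stays in D_j, and the join with [W'] stays in [H]
   because [U] and [W'] are comparable; the two meet inside [U]. *)
apply: subv_trans (sub_aljoinl _ _); rewrite [X in (_ <= X)%VS]UE; apply: capvS.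
  apply: aljoin_min; rewrite ?(flag_subalgebra EC Eflag) // ?UE ?capvSl // VE flag_leq //.
  exact: ltnW.
have [UW|WU] : (U <= W')%VS \/ (W' <= U)%VS.
- by rewrite UE WE; case: (leqP j l) => [|/ltnW] /DHS; [left | right].
- by rewrite (aljoin_subr sW' UW) WE capvSr.
by rewrite (aljoin_subl sU WU) UE capvSr.
Qed.

End FlagSubalgebras.

(** * Natural bases and structure matrices *)

Section FreeTuple.
Variables (K : fieldType) (V : vectType K) (m : nat) (X : m.-tuple V).
Hypothesis Xfree : free X.

Lemma coord_span_take k x (j : 'I_m) : x \in <<take k X>>%VS -> (k <= j)%N -> coord X j x = 0.
Proof.
move=> xX le_kj; have : (<<take k X>> <= lker (linfun (coord X j : V -> K^o)))%VS.
  apply/span_subvP => y /(nthP 0)[i]; rewrite size_take size_tuple => lt_i <-.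
  have [lt_ik lt_im] : (i < k)%N /\ (i < m)%N by move: lt_i; case: (ltnP k m) => ? ?; split; lia.
  rewrite memv_ker lfunE /= nth_take // (coord_free (Ordinal lt_im) j Xfree).
  by rewrite -val_eqE /= ltn_eqF // (leq_trans lt_ik).
by move/subvP/(_ x xX); rewrite memv_ker lfunE => /eqP.
Qed.

Lemma mem_span_take k x : x \in <<X>>%VS ->
  (forall j : 'I_m, (k <= j)%N -> coord X j x = 0) -> x \in <<take k X>>%VS.
Proof.
move=> xX cx; rewrite (coord_span xX); apply: rpred_sum => j _; have [le_kj|lt_jk] := leqP k j.
  by rewrite cx // scale0r mem0v.
rewrite memvZ // memv_span // -(nth_take _ lt_jk) mem_nth //.
by rewrite size_take size_tuple; case: ifP.
Qed.

End FreeTuple.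

(** Distinct natural vectors have product zero, so the square is spanned by their squares, whose
    coordinates are the rows of the matrix. The injective map [h] carries a row basis to a basis of
    the square. *)
Lemma structure_mx_rank (K : fieldType) (E : naAlgType K) m (B : m.-tuple E) :
  natural_basis B -> \rank (structure_mx B) = \dim (alg_square E).
Proof.
case=> bB B0; set M := structure_mx B; pose R := row_base M.
pose h (y : 'rV[K]_m) : E := \sum_k y 0 k *: tnth B k.
have hM p (z : 'rV[K]_p) (N : 'M_(p, m)) : h (z *m N) = \sum_i z 0 i *: h (row i N).
  rewrite /h; under [RHS]eq_bigr do rewrite scaler_sumr.
  rewrite exchange_big; apply: eq_bigr => k _; rewrite mxE scaler_suml.
  by apply: eq_bigr => i _; rewrite mxE scalerA.
have h0 y : h y = 0 -> y = 0.
  move=> hy; apply/rowP=> k; rewrite mxE; move: hy; rewrite /h.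
  under eq_bigr do rewrite (tnth_nth 0); have /freeP fB := basis_free bB.
  by move/(fB (fun k => y 0 k)).
have sqE i : tnth B i ** tnth B i = h (row i M).
  by rewrite (structure_mxP _ bB); apply: eq_bigr => k _; rewrite [row _ _ _ _]mxE.
pose X := [tuple h (row i R) | i < \rank M].
have Xfree : free X.
  apply/freeP => k; under eq_bigr => i _ do rewrite -(tnth_nth 0) tnth_mktuple.
  move=> sum0 i; have /h0 : h ((\row_j k j) *m R) = 0.
    by rewrite hM -[RHS]sum0; apply: eq_bigr => j _; rewrite mxE.
  have /row_freeP[R' RR'] := row_base_free M.
  by move=> /(congr1 (mulmx^~ R')) /rowP/(_ i); rewrite -mulmxA RR' mulmx1 mul0mx !mxE.
suff -> : alg_square E = <<X>>%VS by rewrite (eqnP Xfree) size_tuple.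
apply/eqP; rewrite eqEsubv; apply/andP; split.
  apply/prodsP=> x y _ _; rewrite (coord_basis bB (memvf x)) (coord_basis bB (memvf y)).
  rewrite linear_sumlz rpred_sum // => i _; rewrite linear_sumr rpred_sum // => j _.
  rewrite !amulE !memvZ // -!(tnth_nth 0); have [->|ij] := eqVneq i j; last by rewrite B0 ?mem0v.
  rewrite sqE; have /submxP[d ->] : (row j M <= R)%MS by rewrite eq_row_base row_sub.
  rewrite hM rpred_sum // => l _; rewrite memvZ // memv_span //.
  by apply/tnthP; exists l; rewrite tnth_mktuple.
apply/span_subvP=> _ /tnthP[i ->]; rewrite tnth_mktuple.
have /submxP[d ->] : (row i R <= M)%MS by rewrite (submx_trans (row_sub _ _)) ?eq_row_base.
by rewrite hM rpred_sum // => l _; rewrite -sqE memvZ // mem_prods ?memvf.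
Qed.

(** * From the flag back to a natural basis *)

Section FlagNaturalBasis.
Variables (K : fieldType) (E : naAlgType K) (u v : E) (fs : seq E).
Hypotheses (EC : commutative_alg E) (Eflag : flag_basis u v fs).
Hypotheses (two0 : 2%:R != 0 :> K).

Local Notation n := (\dim {: E}).
Local Notation D k := (<<take k (u :: v :: fs)>>%VS : {vspace E}).

(** The natural pair of E_2(1,-1) recovered from the hyperbolic pair: opposite signs of [v] give
    orthogonality, and the coefficient 1/2 normalizes the squares to [u] and [- u]. *)
Let b0 : E := 2%:R^-1 *: u + v.
Let b1 : E := 2%:R^-1 *: u - v.
Let b : seq E := b0 :: b1 :: fs.

Let half2 : 2%:R^-1 + 2%:R^-1 = 1 :> K.
Proof. by rewrite -[_ + _]mulr2n -[_ *+ 2]mulr_natr mulVf. Qed.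

Let b01 : b0 + b1 = u.
Proof. by rewrite addrACA subrr addr0 -scalerDl half2 scale1r. Qed.

Let span_b k : <<take k.+2 b>>%VS = D k.+2.
Proof.
rewrite /= !span_cons !addvA; congr (_ + _)%VS; apply/eqP.
have uL : u \in (<[u]> + <[v]>)%VS by rewrite (subvP (addvSl _ _)) ?memv_line.
have vL : v \in (<[u]> + <[v]>)%VS by rewrite (subvP (addvSr _ _)) ?memv_line.
have b0L : b0 \in (<[b0]> + <[b1]>)%VS by rewrite (subvP (addvSl _ _)) ?memv_line.
have b1L : b1 \in (<[b0]> + <[b1]>)%VS by rewrite (subvP (addvSr _ _)) ?memv_line.
have uB : u \in (<[b0]> + <[b1]>)%VS by rewrite -b01 rpredD.
rewrite eqEsubv !subv_add -!memvE rpredD ?rpredB ?memvZ //= uB.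
by rewrite -[v](addKr (2%:R^-1 *: u)) addrC rpredB ?memvZ.
Qed.

Lemma flag_hyperbolic_basis :
  [/\ b0 ** b0 = b0 + b1, b1 ** b1 = - (b0 + b1), b0 ** b1 = 0 & b1 ** b0 = 0].
Proof.
have uu := flag_uu Eflag; have vv := flag_vv Eflag; have uv := flag_uv Eflag.
have vu : v ** u = u by rewrite EC.
have e01 : b0 ** b1 = 0.
  by rewrite /b0 /b1 !amulE uu vv uv vu !scaler0 add0r !subr0 ?oppr0 ?addr0 ?addNr ?subrr.
rewrite b01; split=> //; last by rewrite EC.
  by rewrite /b0 !amulE uu vv uv vu !scaler0 add0r addr0 -scalerDl half2 scale1r.
rewrite /b1 !amulE uu vv uv vu !scaler0 ?scalerN ?oppr0 ?add0r ?addr0 ?subr0.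
by rewrite -opprD -scalerDl half2 scale1r.
Qed.

Lemma flag_basis_hyperbolic : basis_of fullv b.
Proof.
rewrite basisEdim (flag_size Eflag) leqnn andbT.
by rewrite -(take_size b) /= (span_b (size fs)) -(flag_size Eflag) (flag_full Eflag).
Qed.

Lemma flag_mul_hyperbolic i j : (i < j < (size fs).+2)%N -> b`_i ** b`_j = 0.
Proof.
have [_ _ e01 _] := flag_hyperbolic_basis.
case: i => [|[|i]]; case: j => [|[|j]] //= Hij.
- by rewrite amulDl amulZl (flag_uf Eflag) ?(flag_vf Eflag) ?mem_nth ?scaler0 ?addr0.
- by rewrite amulDl amulNl amulZl (flag_uf Eflag) ?(flag_vf Eflag) ?mem_nth ?scaler0 ?subr0.
by apply: (flag_ff Eflag).
Qed.

Let bsize : size b == (2 + (n - 2))%N.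
Proof. by rewrite (flag_size Eflag) subn2. Qed.

Local Notation B := (Tuple bsize).

Let Bbasis : basis_of fullv B. Proof. exact: flag_basis_hyperbolic. Qed.
Let Bfree : free B. Proof. exact: basis_free Bbasis. Qed.
Let le_fs : (n - 2)%N = size fs. Proof. by rewrite (flag_size Eflag) subn2. Qed.

Lemma flag_natural_basis : natural_basis B.
Proof.
split=> // i j; rewrite !(tnth_nth 0) => neq_ij.
have lt_b (l : 'I_(2 + (n - 2))) : (l < (size fs).+2)%N by rewrite -le_fs; case: l.
have [lt_ij|lt_ji|/val_inj eq_ij] := ltngtP i j; last by rewrite eq_ij eqxx in neq_ij.
  by rewrite flag_mul_hyperbolic ?lt_ij ?lt_b.
by rewrite EC flag_mul_hyperbolic ?lt_ji ?lt_b.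
Qed.

Hypothesis Esq : \dim (alg_square E) = n.-1.

Lemma flag_structure_mx : exists B : (2 + (n - 2)).-tuple E,
  [/\ natural_basis B,
      exists C (L : 'M[K]_(n - 2)),
        [/\ structure_mx B = block_mx (\matrix_(i < 2, j < 2) (-1) ^+ i) 0 C L,
            strictly_lower L &
            forall i j : 'I_(n - 2), i = j.+1 :> nat -> L i j != 0] &
      \rank (structure_mx B) = (n - 1)%N].
Proof.
exists B; split; first exact: flag_natural_basis; last first.
  by rewrite (structure_mx_rank flag_natural_basis) Esq subn1.
have sqD (i : 'I_(n - 2)) : fs`_i ** fs`_i \in <<take i.+2 b>>%VS.
  by rewrite span_b; apply: (flag_sq Eflag); rewrite -le_fs.
have LE i j : structure_mx B (rshift 2 i) (rshift 2 j) = coord B (rshift 2 j) (fs`_i ** fs`_i).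
  by rewrite mxE !(tnth_nth 0) /= .
exists (dlsubmx (structure_mx B)), (drsubmx (structure_mx B)); split.
- rewrite -[LHS]submxK.
  have [e0 e1 _ _] := flag_hyperbolic_basis.
  have sq2 (i : 'I_2) j : structure_mx B (lshift (n - 2) i) j =
      (-1) ^+ i * ((lshift (n - 2) (0 : 'I_2) == j)%:R + (lshift (n - 2) (1 : 'I_2) == j)%:R).
    have c01 : coord B j (b0 + b1) =
        ((lshift (n - 2) (0 : 'I_2) == j)%:R + (lshift (n - 2) (1 : 'I_2) == j)%:R).
      rewrite linearD /=; congr (_ + _).
        exact: (coord_free (lshift (n - 2) (0 : 'I_2)) j Bfree).
      exact: (coord_free (lshift (n - 2) (1 : 'I_2)) j Bfree).
    rewrite mxE !(tnth_nth 0); case: i => [[|[|//]] ?] /=.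
      by rewrite e0 c01 mul1r.
    by rewrite e1 linearN /= c01 expr1 mulN1r.
  congr block_mx; apply/matrixP=> i j; rewrite [RHS]mxE [LHS]mxE [LHS]mxE sq2.
    by case: j => [[|[|//]] ?]; rewrite -!val_eqE /= ?addr0 ?add0r mulr1.
  by rewrite -!val_eqE /= addr0 mulr0.
- move=> i j le_ij; rewrite !mxE -[LHS]/(coord B _ _) !(tnth_nth 0) /=.
  exact: (coord_span_take Bfree (sqD i)).
(* Row [i] of [L] belongs to the flag vector of index [i.+2]. A zero just below the diagonal would
   put its square in [D i.+1], against [flag_sq_notin]. *)
move=> i j ij; rewrite 2!mxE LE; apply/eqP => c0.
have := flag_sq_notin EC Eflag Esq (k := i.+2).
have lt_i : (i.+2 < n)%N by have := ltn_ord i; rewrite ltn_subRL add2n.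
rewrite lt_i => /(_ isT) /negP[]; rewrite /= ij -span_b -ij.
apply: (mem_span_take (X := B)); first by rewrite (span_basis Bbasis) memvf.
move=> l; rewrite leq_eqVlt => /predU1P[eq_l|lt_l].
  by rewrite -[RHS]c0; congr (coord B _ _); apply: val_inj; rewrite /= -eq_l ij.
exact: (coord_span_take Bfree (sqD i)).
Qed.

End FlagNaturalBasis.

(** * Quotients *)

Lemma prods_span_sub (K : fieldType) (E : naAlgType K) (X Y : seq E) (W : {vspace E}) :
  {in X & Y, forall x y, x ** y \in W} -> (prods <<X>> <<Y>> <= W)%VS.
Proof.
move=> XY; apply/prodsP=> x y.
rewrite -[X]in_tupleE -[Y]in_tupleE => /coord_span-> /coord_span->.
rewrite linear_sumlz rpred_sum // => i _; rewrite linear_sumr rpred_sum // => j _.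
by rewrite !amulE !memvZ // XY // ?in_tupleE mem_nth.
Qed.

Section ChainAlgebra.
Variables (K : fieldType) (F : naAlgType K) (m : nat) (b : m.-tuple F).
Hypotheses (m_gt0 : (0 < m)%N) (bnat : natural_basis b).
Hypothesis b00 : b`_0 ** b`_0 = 0.
Hypothesis bS : forall i, (i.+1 < m)%N -> b`_i.+1 ** b`_i.+1 = b`_i.

Let mem_take i k : (i < m)%N -> (i < k)%N -> b`_i \in take k b.
Proof.
move=> lt_im lt_ik; rewrite -(nth_take _ lt_ik) mem_nth // size_take size_tuple.
by case: ifP.
Qed.

(** The span of the first m - t basis vectors contains [right_pow t] and is contained in
    [spow t.+1], so the two estimates of [nilpotency_index_pow2] meet. *)
Lemma chain_nilpotency_index : nilpotency_index F (2 ^ m.-1).+1.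
Proof.
have bfull : (<<b>> = fullv)%VS := span_basis bnat.1.
have takeP k x : x \in take k b -> exists i, [/\ (i < k)%N, (i < m)%N & x = b`_i].
  move=> /(nthP 0)[i]; rewrite size_take size_tuple => lt_i <-; exists i.
  have [lt_ik lt_im] : (i < k)%N /\ (i < m)%N by move: lt_i; case: (ltnP k m) => ? ?; split; lia.
  by rewrite nth_take.
have b0 i j : (i < m)%N -> (j < m)%N -> i != j -> b`_i ** b`_j = 0.
  move=> lt_i lt_j neq; have := bnat.2 (Ordinal lt_i) (Ordinal lt_j).
  by rewrite !(tnth_nth 0) /=; apply.
have sq_take i k : (i < m)%N -> (i <= k)%N -> b`_i ** b`_i \in <<take k b>>%VS.
  case: i => [|i] lt_im le_ik; first by rewrite b00 mem0v.
  by rewrite bS // memv_span // mem_take // ltnW.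
apply: (nilpotency_index_pow2 (natural_basis_comm bnat)) => //.
  apply/eqP; rewrite -subv0 -(span_nil F) -(take0 b) -(subnn m).
  suff H t : (right_pow F t <= <<take (m - t) b>>)%VS by apply: H.
  elim: t => [|t IHt]; first by rewrite subn0 take_oversize ?size_tuple // bfull subvf.
  rewrite right_powS; apply: subv_trans (prodsS IHt (subvv _)) _.
  rewrite -bfull; apply: prods_span_sub => x y /takeP[i [lt_it lt_im ->]] /(nthP 0)[j].
  rewrite size_tuple => lt_j <-; have [<-|neq] := eqVneq i j; last by rewrite b0 ?mem0v.
  by apply: sq_take => //; lia.
suff H t : (t < m)%N -> (<<take (m - t) b>> <= spow F t.+1)%VS.
  have := H m.-1; rewrite prednK // => /(_ (leqnn _)); rewrite -{1}(prednK m_gt0) subSnn => Hm.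
  apply/eqP=> S0; move: Hm; rewrite S0 => /subvP/(_ b`_0).
  rewrite memv_span ?mem_take // => /(_ isT); rewrite memv0 => /eqP bz.
  have b0b : b`_0 \in b by rewrite mem_nth ?size_tuple.
  by have := free_not0 (basis_free bnat.1) b0b; rewrite bz eqxx.
elim: t => [|t IHt] lt_t; first by rewrite subn0 take_oversize ?size_tuple // bfull subvf.
rewrite spowS //; apply/span_subvP => x /takeP[i [lt_it lt_im ->]].
have lt_i : (i.+1 < m)%N by lia.
by rewrite -bS // mem_prods // (subvP (IHt (ltnW lt_t))) // memv_span // mem_take //; lia.
Qed.

End ChainAlgebra.

(** Maximality is defined by comparison with all algebras of the same dimension; this model, in
    which each basis vector squares to its predecessor, turns it into a numerical bound. *)
Lemma exists_max_nilpotency_index (K : fieldType) m : (0 < m)%N ->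
  exists F : naAlgType K, [/\ \dim {: F} = m, evolution F & nilpotency_index F (2 ^ m.-1).+1].
Proof.
move=> m_gt0; pose M : 'M[K]_m := \matrix_(i, j) (i == j.+1 :> nat)%:R.
have [bnat bM] := evo_stdP M; exists (evo_alg M); set b := evo_std M in bnat bM.
have sqE (i : 'I_m) : tnth b i ** tnth b i = \sum_(k < m) (i == k.+1 :> nat)%:R *: tnth b k.
  by rewrite (structure_mxP _ bnat.1) bM; apply: eq_bigr => k _; rewrite mxE.
split; first by have /andP[/eqP <- /eqP ->] := bnat.1; rewrite size_tuple.
  by exists m, b.
apply: (chain_nilpotency_index (b := b)) => // [|i lt_i].
  have := sqE (Ordinal m_gt0); rewrite (tnth_nth 0) /= => ->.
  by apply: big1 => k _; rewrite scale0r.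
have := sqE (Ordinal lt_i); rewrite (tnth_nth 0) /= => ->.
rewrite (bigD1 (Ordinal (ltnW lt_i))) //= eqxx scale1r (tnth_nth 0) big1 ?addr0 // => k neq.
by rewrite eqSS eq_sym -[k == _ :> nat]/(k == Ordinal (ltnW lt_i)) (negPf neq) scale0r.
Qed.

Section QuotientByIdeal.
Variables (K : fieldType) (E : naAlgType K) (I : {vspace E}).
Hypothesis Iideal : ideal I.

Definition quot_hom : 'Hom(E, quot_alg I) := linfun (@quot_proj K E I).

Lemma quot_homM : {morph quot_hom : x y / x ** y}.
Proof. by move=> x y; rewrite /quot_hom !lfunE; apply: quot_projM. Qed.

Lemma quot_hom_eq0 x : (quot_hom x == 0) = (x \in I).
Proof. by rewrite /quot_hom lfunE; apply: quot_proj_eq0. Qed.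

Lemma lker_quot_hom : lker quot_hom = I.
Proof. by apply/vspaceP=> x; rewrite memv_ker quot_hom_eq0. Qed.

Lemma limg_quot_hom : limg quot_hom = fullv.
Proof.
apply/eqP; rewrite eqEsubv subvf; apply/subvP=> y _.
by have [x <-] := quot_proj_surj y; rewrite -[quot_proj I x]lfunE memv_img ?memvf.
Qed.

Lemma dim_quot_alg : (\dim I + \dim {: quot_alg I})%N = \dim {: E}.
Proof. by have := limg_ker_dim quot_hom fullv; rewrite capfv lker_quot_hom limg_quot_hom. Qed.

Lemma quot_square : (quot_hom @: alg_square E)%VS = alg_square (quot_alg I).
Proof. by rewrite (limg_prods quot_homM) limg_quot_hom. Qed.

(** Comparison with the chain algebra shows that the square of the quotient has codimension one
    there. Dividing by an ideal inside E^2 does not change the codimension of the square. *)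
Lemma max_nilpotency_quot_square : (I <= alg_square E)%VS -> (\dim I < \dim {: E})%N ->
  max_nilpotency_index (quot_alg I) -> \dim (alg_square E) = (\dim {: E}).-1.
Proof.
move=> IE ltIE [Nev [k Nk kmax]].
have N_gt0 : (0 < \dim {: quot_alg I})%N by rewrite -dim_quot_alg in ltIE; lia.
have NC := evolution_comm Nev.
have [F [dimF Fev Fk]] := exists_max_nilpotency_index K N_gt0.
pose d := \dim {: quot_alg I}; pose d2 := \dim (alg_square (quot_alg I)).
have ge_d2 : (d.-1 <= d2)%N := nilpotency_index_square NC Nk (kmax F _ dimF Fev Fk).
have le_d2 : (d2 <= d - 1)%N.
  by apply: (nilpotent_right_pow (E := quot_alg I) _ 1); case: Nk => ? ? _; exists k.
have dE : (\dim I + d)%N = \dim {: E} := dim_quot_alg.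
have := limg_ker_dim quot_hom (alg_square E).
rewrite lker_quot_hom quot_square (capv_idPr IE) -/d2 -dE; rewrite -/d in N_gt0; lia.
Qed.

End QuotientByIdeal.

Section FlagQuotient.
Variables (K : fieldType) (E : naAlgType K) (u v : E) (fs : seq E).
Hypotheses (EC : commutative_alg E) (Eflag : flag_basis u v fs).
Hypothesis Esq : \dim (alg_square E) = (\dim {: E}).-1.
Hypothesis uideal : ideal <[u]>%VS.

Local Notation n := (\dim {: E}).
Local Notation D k := (<<take k (u :: v :: fs)>>%VS : {vspace E}).
Local Notation Q := (quot_hom <[u]>%VS).
Local Notation N := (quot_alg <[u]>%VS).

Lemma flag_quot_dim : \dim {: N} = n.-1.
Proof. by rewrite -(dim_quot_alg <[u]>%VS) dim_vline (flag_u_neq0 Eflag). Qed.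

Lemma flag_quot_evolution : evolution N.
Proof.
pose b := [tuple of Q v :: map Q (in_tuple fs)]; exists (size fs).+1, b.
have QM := quot_homM uideal.
have Qu : Q u = 0 by apply/eqP; rewrite quot_hom_eq0 memv_line.
have bmul i j : (i < j < (size fs).+1)%N -> b`_i ** b`_j = 0.
  case: j => // j; case: i => [|i] /= Hij.
    by rewrite (nth_map 0) // -QM (flag_vf Eflag) ?mem_nth ?linear0.
  have lt_i : (i < size fs)%N by lia.
  by rewrite !(nth_map 0) // -?QM ?(flag_ff Eflag) ?linear0 //; case/andP: Hij.
split=> [|i j].
  rewrite basisEdim size_tuple flag_quot_dim (flag_size Eflag) leqnn andbT.
  have <- : limg Q = fullv := limg_quot_hom _.
  rewrite -(span_basis (flag_basis_of Eflag)) limg_span /= span_cons Qu vline0 add0v.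
  exact: subvv.
rewrite !(tnth_nth 0) => neq_ij.
have NC (x y : N) : x ** y = y ** x.
  have [x' <-] := quot_proj_surj x; have [y' <-] := quot_proj_surj y.
  by rewrite -!(quot_projM uideal) EC.
have [lt_ij|lt_ji|/val_inj eq_ij] := ltngtP i j; last by rewrite eq_ij eqxx in neq_ij.
  by rewrite bmul ?lt_ij ?ltn_ord.
by rewrite NC bmul ?lt_ji ?ltn_ord.
Qed.

(** With m = n - 1 in [nilpotency_index_pow2]: the right power lies in the image of [D 1], which is
    zero, while the derived term is the image of [D 2] and still contains the class of [v]. *)
Lemma flag_quot_max_nilpotency : max_nilpotency_index N.
Proof.
have n_gt1 : (1 < n)%N by rewrite (flag_size Eflag).
split; first exact: flag_quot_evolution.
have NC := evolution_comm flag_quot_evolution; have QM := quot_homM uideal.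
have N_gt0 : (0 < \dim {: N})%N by rewrite flag_quot_dim; lia.
exists (2 ^ (\dim {: N}).-1).+1 => [|F j dimF Fev Fj]; last first.
  rewrite -dimF; apply: nilpotency_index_leq Fj; last by rewrite dimF.
  exact: evolution_comm.
apply: nilpotency_index_pow2 => //; rewrite flag_quot_dim.
  suff H t : (t < n)%N -> (right_pow N t <= Q @: D (n - t))%VS.
    apply/eqP; rewrite -subv0; apply: subv_trans (H n.-1 _) _; first by lia.
    have -> : (n - n.-1 = 1)%N by lia.
    by rewrite flag1 subv0 -lkerE lker_quot_hom.
  elim: t => [|t IHt] lt_t; first by rewrite subn0 (flag_full Eflag) limg_quot_hom subvf.
  rewrite right_powS; apply: subv_trans (prodsS (IHt (ltnW lt_t)) (subvv _)) _.
  rewrite -(limg_quot_hom <[u]>%VS) -(limg_prods QM) limgS // -(subnSK (ltnW lt_t)).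
  by apply: (flag_mulr_sub EC Eflag); lia.
have -> : (n.-1 = n.-2.+1)%N by lia.
rewrite -(limg_iter_spow QM _ (limg_quot_hom _)) (flag_spow EC Eflag Esq); last by lia.
have -> : (n - n.-2 = 2)%N by lia.
rewrite -lkerE lker_quot_hom; apply/negP => /subvP/(_ v (flag_v _ _ _)).
have := flag_nth_notin Eflag n_gt1.
by rewrite flag1 /= => /negP.
Qed.

End FlagQuotient.

(** * The algebras E_k and the family F *)

(** The term [spow E n] is non-zero and lies n - 2 steps below E^2 in the derived series, so E^2 has
    dimension at least n - 1; solvability gives the other inequality. *)
Lemma max_solvability_square (K : fieldType) (E : naAlgType K) : (1 < \dim {: E})%N ->
  max_solvability_index E -> \dim (alg_square E) = (\dim {: E}).-1.
Proof.
set n := \dim _ => n_gt1 [_ S0 Smin].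
have le_sq : (\dim (alg_square E) <= n - 1)%N := dim_iter_leq (@spow_dec _ E) S0 1.
have iterE t : iter t (fun U => prods U U) (alg_square E) = spow E t.+2.
  by rewrite -iterSr.
have decE t : (spow E t.+3 <= spow E t.+2)%VS by apply: (@spow_dec _ E t.+1).
have zE : iter n.-1 (fun U => prods U U) (alg_square E) = 0%VS.
  by rewrite iterE -[RHS]S0; congr spow; lia.
have le_n : (\dim (spow E n.-2.+2) <= \dim (alg_square E) - n.-2)%N.
  by rewrite -iterE; apply: dim_iter_leq zE _ => t; rewrite !iterE.
have : (0 < \dim (spow E n))%N by rewrite lt0n dimv_eq0 Smin //; lia.
move: le_n; have -> : n.-2.+2 = n by lia.
lia.
Qed.

Section CoordRow.
Variables (K : fieldType) (F : naAlgType K) (m : nat) (B : m.-tuple F).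

Definition coord_row (x : F) : evo_alg (structure_mx B) := \row_i coord B i x.

Fact coord_row_linear : linear coord_row.
Proof. by move=> a x y; apply/rowP=> i; rewrite !mxE linearP. Qed.
HB.instance Definition _ := GRing.isSemilinear.Build K F (evo_alg (structure_mx B)) _ coord_row
  (GRing.semilinear_linear coord_row_linear).

Lemma natural_basis_iso : natural_basis B -> alg_iso F (evo_alg (structure_mx B)).
Proof.
move=> Bnat; have [bB _] := Bnat; exists (coord_row : {linear F -> evo_alg (structure_mx B)}).
  exists (fun y : evo_alg (structure_mx B) => \sum_i y 0 i *: B`_i) => [x|y].
    by rewrite [RHS](coord_basis bB (memvf x)); apply: eq_bigr => i _; rewrite mxE.
  by apply/rowP=> i; rewrite mxE coord_sum_free // (basis_free bB).
move=> x y; apply/rowP=> j; rewrite mxE (natural_basis_mulE _ _ Bnat) linear_sum.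
rewrite /almul /= /evo_mul [RHS]mxE; apply: eq_bigr => i _.
by rewrite linearZ !mxE.
Qed.

End CoordRow.

Definition hyperbolic (K : fieldType) (F : naAlgType K) (u v : F) :=
  [/\ u != 0, u ** u = 0, v ** v = 0, u ** v = u & forall x y, x ** y \in <[u]>%VS].

Lemma hyperbolic_dim (K : fieldType) (F : naAlgType K) (u v : F) : hyperbolic u v ->
  \dim (<[u]> + <[v]>) = 2%N.
Proof.
case=> u0 uu vv uv _; rewrite dimv_disjoint_sum ?dim_vline ?u0.
  by case: eqP => // v0; rewrite -uv v0 amul0r eqxx in u0.
apply/eqP; rewrite -subv0; apply/subvP=> x; rewrite memv_cap => /andP[/vlineP[c ->] /vlineP[d cd]].
have : d *: u = 0 by rewrite -uv -amulZr -cd amulZr uu scaler0.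
move/eqP; rewrite scaler_eq0 (negPf u0) orbF => /eqP d0.
by rewrite cd d0 scale0r mem0v.
Qed.

Lemma hyperbolic_square (K : fieldType) (F : naAlgType K) (u v : F) : hyperbolic u v ->
  alg_square F = <[u]>%VS.
Proof.
case=> _ _ _ uv Fu; apply/eqP; rewrite eqEsubv; apply/andP; split.
  by apply/prodsP=> x y _ _.
by rewrite -memvE -uv mem_prods ?memvf.
Qed.

Lemma Ek_hyperbolic (K : fieldType) (F : naAlgType K) s k (lam : 'I_s -> K) (B : s.-tuple F) :
  2%:R != 0 :> K -> Ek_basis k lam B -> ~ nilpotent_alg F -> exists u v : F, hyperbolic u v.
Proof.
move=> two0 [[_ _ lam0] Bnat SB] notnil; have FC := natural_basis_comm Bnat.
pose u := \sum_(j < s | (j < k)%N) tnth B j.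
have sqB i : tnth B i ** tnth B i = lam i *: u.
  rewrite (structure_mxP _ Bnat.1) SB scaler_sumr [RHS]big_mkcond; apply: eq_bigr => j _.
  by rewrite mxE; case: ifP => _ //; rewrite scale0r.
have mulu x y : x ** y \in <[u]>%VS.
  rewrite (natural_basis_mulE _ _ Bnat) rpred_sum // => i _.
  by rewrite sqB !memvZ ?memv_line.
have Bu (i : 'I_s) : (i < k)%N -> tnth B i ** u = lam i *: u.
  move=> lt_ik; rewrite linear_sumr (bigD1 i) //= big1 ?addr0 // => j /andP[_ ji].
  by rewrite Bnat.2 // eq_sym.
have BuN (i : 'I_s) : ~~ (i < k)%N -> tnth B i ** u = 0.
  move=> ge_ik; rewrite linear_sumr big1 // => j lt_jk; rewrite Bnat.2 //.
  by apply: contraNneq ge_ik => ->.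
(* If all scalars with index below [k] vanished, [u] would annihilate the algebra; all products
   being multiples of [u], E^3 would be zero. *)
have [j lt_jk lamj] : exists2 j : 'I_s, (j < k)%N & lam j != 0.
  case: (pickP (fun j : 'I_s => (j < k)%N && (lam j != 0))) => [j /andP[]|none]; first by exists j.
  case: notnil; exists 3%N => //; apply/eqP; rewrite -subv0.
  apply: subv_trans (npow_right_pow FC (t := 1) _) _ => //.
  rewrite !right_powS; apply: (@subv_trans _ _ (prods <[u]> fullv)).
    by rewrite prodsS //; apply/prodsP=> x y _ _; apply: mulu.
  apply/prodsP=> _ y /vlineP[c ->] _; rewrite amulZl FC (coord_basis Bnat.1 (memvf y)).
  rewrite linear_sumlz big1 ?scaler0 ?mem0v // => i _; rewrite amulZl -(tnth_nth 0).
  have [lt_ik|ge_ik] := boolP (i < k)%N; last by rewrite BuN ?scaler0.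
  by have := none i; rewrite lt_ik /= => /negbFE/eqP l0; rewrite Bu // l0 scale0r scaler0.
have uu : u ** u = 0.
  rewrite {1}/u linear_sumlz; under eq_bigr => i lt_ik do rewrite Bu //.
  by rewrite -scaler_suml lam0 scale0r.
have u0 : u != 0.
  apply/eqP=> u0; have /freeP fB := basis_free Bnat.1.
  have : \sum_(i < s) (i < k)%:R *: B`_i = 0.
    rewrite -[RHS]u0 [RHS]big_mkcond; apply: eq_bigr => i _; rewrite -(tnth_nth 0).
    by case: (i < k)%N; rewrite ?scale1r ?scale0r.
  by move/(fB (fun i => (i < k)%:R))/(_ j)/eqP; rewrite lt_jk oner_eq0.
(* With e the [j]-th basis vector, e^2 and e u both equal [lam j *: u], so subtracting u/2 cancels
   the square; dividing by [lam j] normalizes the product with [u]. *)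
exists u, ((lam j)^-1 *: (tnth B j - 2%:R^-1 *: u)); split=> //; last first.
  by rewrite !amulE uu FC Bu // scaler0 subr0 scalerA mulVf // scale1r.
suff z : (tnth B j - 2%:R^-1 *: u) ** (tnth B j - 2%:R^-1 *: u) = 0.
  by rewrite amulZl amulZr z !scaler0.
rewrite amulDl amulNl amulZl !amulDr !amulNr !amulZr uu sqB [u ** _]FC Bu //.
rewrite !scaler0 subr0.
have half2 : 2%:R^-1 + 2%:R^-1 = 1 :> K by rewrite -[_ + _]mulr2n -[_ *+ 2]mulr_natr mulVf.
by rewrite -addrA -opprD -scalerDl half2 scale1r subrr.
Qed.

(** The block form of the structure matrix without coordinates: orthogonal images of the E_i,
    followed by the remaining natural vectors [gs]. Injectivity of the [f i] follows from
    [split_full] and [split_dim] by counting. *)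
Record family_split (K : fieldType) r (Es : 'I_r -> naAlgType K) (E : naAlgType K)
    (f : forall i, 'Hom(Es i, E)) (gs : seq E) : Prop := FamilySplit {
  split_comm : commutative_alg E;
  split_morph : forall i, {morph f i : x y / x ** y};
  split_orth : forall i j x y, i != j -> f i x ** f j y = 0;
  split_fg : forall i x, {in gs, forall y, f i x ** y = 0};
  split_gg : forall a b, (a < b < size gs)%N -> gs`_a ** gs`_b = 0;
  split_sq : forall t, (t < size gs)%N ->
    gs`_t ** gs`_t \in (\sum_i limg (f i) + <<take t gs>>)%VS;
  split_full : fullv = (\sum_i limg (f i) + <<gs>>)%VS;
  split_dim : \dim {: E} = (\sum_i \dim {: Es i} + size gs)%N }.

Lemma family_embedding_split (K : fieldType) r (Es : 'I_r -> naAlgType K) (s : 'I_r -> nat)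
    (Bs : forall i, (s i).-tuple (Es i)) (E : naAlgType K) (f : forall i, 'Hom(Es i, E)) :
  (forall i, natural_basis (Bs i)) -> family_embedding Bs f ->
  exists gs, family_split f gs.
Proof.
move=> natBs [q [B [natB fB [C [L [Llow SB]]]]]]; have [bB B0] := natB.
pose G t := tnth B (rshift (\sum_i s i) t); pose gs := [tuple G t | t < q].
have gsE (t : 'I_q) : gs`_t = G t by rewrite -tnth_nth tnth_mktuple.
have fE i x : f i x = \sum_j coord (Bs i) j x *: tnth B (lshift q (tagnat.Rank i j)).
  rewrite {1}(coord_basis (natBs i).1 (memvf x)) linear_sum.
  by apply: eq_bigr => j _; rewrite linearZ /= -fB (tnth_nth 0).
have Blimg p : tnth B (lshift q p) \in (\sum_i limg (f i))%VS.
  rewrite -(tagnat.sig2K p) -fB; set i := tagnat.sig1 p.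
  by apply: (subvP (sumv_sup i _ (subvv _))) => //; rewrite memv_img ?memvf.
have f0 i x l : (forall j, l != lshift q (tagnat.Rank i j)) -> f i x ** tnth B l = 0.
  move=> lN; rewrite fE linear_sumlz big1 // => j _.
  by rewrite amulZl B0 ?scaler0 // eq_sym.
exists gs; split.
- exact: natural_basis_comm natB.
- move=> i x y.
  (* On a natural basis multiplicativity reduces to squares, and in row [Rank i j] only the [i]-th
     diagonal block contributes. *)
  have fsq j : f i (tnth (Bs i) j ** tnth (Bs i) j) =
      f i (tnth (Bs i) j) ** f i (tnth (Bs i) j).
    rewrite fB (structure_mxP _ bB) SB big_split_ord /=.
    rewrite [X in _ + X]big1 ?addr0 => [|k _]; last by rewrite block_mxEur mxE scale0r.
    rewrite (reindex _ (onW_bij _ (@tagnat.rank_bij _ s))) /=.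
    set S0 := \mxdiag_(a < r) structure_mx (Bs a).
    have S0E a k : S0 (tagnat.Rank i j) (tagnat.Rank a k) = submxblock S0 i a j k.
      by rewrite [RHS]mxE.
    transitivity (\sum_a \sum_k S0 (tagnat.Rank i j) (@tagnat.Rank _ s a k) *:
                   tnth B (lshift q (tagnat.Rank a k))).
      rewrite (bigD1 i) //= [X in _ + X]big1 ?addr0 => [|a ai].
        rewrite fE; apply: eq_bigr => k _.
        by rewrite S0E submxblock_diag mxE.
      by apply: big1 => k _; rewrite S0E mxblockK eq_sym (negPf ai) mxE scale0r.
    by rewrite sig_big_dep /=; apply: eq_bigr => p _; rewrite block_mxEul tagnat.rankE.
  rewrite (natural_basis_mulE _ _ (natBs i)) linear_sum !fE linear_sumlz.
  apply: eq_bigr => j _; rewrite linearZ /= fsq fB linear_sumr (bigD1 j) //=.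
  rewrite [X in _ + X]big1 ?addr0 => [|l lj]; first by rewrite !amulE scalerA.
  rewrite !amulE B0 ?scaler0 //.
  apply: contraNneq lj => /lshift_inj/tagnat.rank_inj jl.
  by rewrite (eq_from_Tagged jl).
- move=> i j x y ij; rewrite (fE j) linear_sumr big1 // => l _; rewrite amulZr f0 ?scaler0 // => m.
  apply: contraNneq ij => /lshift_inj eq_R.
  by rewrite -(tagnat.Rank1K l) eq_R tagnat.Rank1K.
- move=> i x _ /tnthP[t ->]; rewrite tnth_mktuple f0 // => m.
  by rewrite eq_sym eq_lrshift.
- move=> a b; rewrite size_tuple => /andP[lt_ab lt_b].
  rewrite (gsE (Ordinal (ltn_trans lt_ab lt_b))) (gsE (Ordinal lt_b)) B0 //.
  by rewrite eq_rshift -val_eqE /= ltn_eqF.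
- move=> t; rewrite size_tuple => lt_t; rewrite (gsE (Ordinal lt_t)) (structure_mxP _ bB) SB.
  rewrite big_split_ord /= memv_add // rpred_sum // => p _; first by rewrite memvZ.
  rewrite block_mxEdr; have [le_tp|lt_pt] := leqP t p; first by rewrite Llow // scale0r mem0v.
  rewrite memvZ // memv_span // -[tnth B _]gsE -(nth_take _ lt_pt) mem_nth //.
  by rewrite size_takel // size_tuple ltnW.
- apply/eqP; rewrite eqEsubv subvf andbT -(span_basis bB); apply/span_subvP => _ /tnthP[l ->].
  rewrite -(splitK l); case: (split l) => p /=.
    by rewrite (subvP (addvSl _ _)).
  by rewrite (subvP (addvSr _ _)) // memv_span // -[tnth B _]gsE mem_nth ?size_tuple.
rewrite size_tuple; have /andP[/eqP <- /eqP ->] := bB; rewrite size_tuple; congr (_ + _)%N.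
by apply: eq_bigr => i _; have /andP[/eqP <- /eqP ->] := (natBs i).1; rewrite size_tuple.
Qed.

Lemma dim_limg_leq (K : fieldType) (V W : vectType K) (f : 'Hom(V, W)) U :
  (\dim (f @: U) <= \dim U)%N.
Proof. by rewrite -[X in (_ <= X)%N](limg_ker_dim f) leq_addl. Qed.

Section Split.
Variables (K : fieldType) (r : nat) (Es : 'I_r -> naAlgType K) (E : naAlgType K).
Variables (f : forall i, 'Hom(Es i, E)) (gs : seq E).
Hypothesis fs : family_split f gs.
Hypothesis Eshyp : forall i, exists u v : Es i, hyperbolic u v.

Lemma split_dim_ge2 i : (2 <= \dim {: Es i})%N.
Proof. by have [u [v /hyperbolic_dim <-]] := Eshyp i; rewrite dimvS ?subvf. Qed.

Lemma split_inj i : lker (f i) = 0%VS.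
Proof.
have := limg_ker_dim (f i) fullv; rewrite capfv => dimi.
apply/eqP; rewrite -dimv_eq0 -leqn0.
have : (\dim {: E} <= \sum_j \dim (limg (f j)) + size gs)%N.
  rewrite {1}(split_full fs); apply: leq_trans (dimv_add_leqif _ _).1 _.
  by rewrite leq_add ?dim_span // dimv_leq_sum.
rewrite (split_dim fs) leq_add2r (bigD1 i) //= [X in (_ <= X)%N](bigD1 i) //= => le_sum.
rewrite -(leq_add2r (\dim (limg (f i)))) add0n dimi.
rewrite -(leq_add2r (\sum_(j | j != i) \dim {: Es j})); apply: leq_trans le_sum _.
by rewrite leq_add2l; apply: leq_sum => j _; apply: dim_limg_leq.
Qed.

Lemma split_f_eq0 i x : (f i x == 0) = (x == 0).
Proof. by rewrite -memv_ker split_inj memv0. Qed.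

Lemma split_square : alg_square E =
  (\sum_i f i @: alg_square (Es i) + <<[seq x ** x | x <- gs]>>)%VS.
Proof.
have EC := split_comm fs.
apply/eqP; rewrite eqEsubv; apply/andP; split; last first.
  rewrite subv_add; apply/andP; split.
    by apply/subv_sumP => i _; rewrite (limg_prods (split_morph fs (i:=i))) prodsS ?subvf.
  by apply/span_subvP=> _ /mapP[x _ ->]; rewrite mem_prods ?memvf.
rewrite /alg_square {1 2}(split_full fs).
rewrite !(prodsDl, prodsDr) !subv_add.
have z : prods (\sum_i limg (f i)) <<gs>> = 0%VS.
  apply: prods_eq0 => x y /memv_sumP[xs xsE ->] yg; rewrite linear_sumlz big1 // => i _.
  have /memv_imgP[x' _ ->] := xsE i isT.
  by apply: amul_span0 yg => w /(split_fg fs x').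
rewrite (prodsC <<gs>>) // z !sub0v !andbT /=; apply/andP; split.
  apply: subv_trans (addvSl _ _); apply/prodsP=> x y /memv_sumP[xs xsE ->] /memv_sumP[ys ysE ->].
  rewrite linear_sumlz rpred_sum // => i _; rewrite linear_sumr rpred_sum // => j _.
  have /memv_imgP[x' _ ->] := xsE i isT; have /memv_imgP[y' _ ->] := ysE j isT.
  have [ij|ij] := eqVneq i j; last by rewrite (split_orth fs) ?mem0v.
  case: j / ij in ys ysE y' *; rewrite -(split_morph fs).
  apply: (subvP (sumv_sup i _ (subvv _))) => //.
  by rewrite memv_img ?mem_prods ?memvf.
apply: subv_trans (addvSr _ _); apply: prods_span_sub => x y.
move=> /(nthP 0)[i lt_i <-] /(nthP 0)[j lt_j <-].
have [lt_ij|lt_ji|<-] := ltngtP i j.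
- by rewrite (split_gg fs) ?lt_ij ?mem0v.
- by rewrite EC (split_gg fs) ?lt_ji ?mem0v.
by rewrite memv_span // (map_f (fun x : E => x ** x)) ?mem_nth.
Qed.

Definition split_hyperbolic (i1 : 'I_r) := (forall i, i = i1) /\ \dim {: Es i1} = 2%N.

(** Each E_i has dimension at least 2 but contributes only one dimension to E^2, and each vector of
    [gs] at most one. Codimension one then bounds the sum of the dim E_i by r + 1, while this sum is
    at least 2r. *)
Lemma split_square_hyperbolic i1 : \dim (alg_square E) = (\dim {: E}).-1 -> split_hyperbolic i1.
Proof.
move=> Esq.
have : (\dim (alg_square E) <= r + size gs)%N.
  rewrite split_square; apply: leq_trans (dimv_add_leqif _ _).1 _.
  apply: leq_add; last by rewrite -(size_map (fun x : E => x ** x)) dim_span.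
  apply: leq_trans (dimv_leq_sum _ _ _) _; rewrite -[X in (_ <= X)%N]card_ord -sum1_card.
  apply: leq_sum => i _; apply: leq_trans (dim_limg_leq _ _) _.
  have [u [v huv]] := Eshyp i; rewrite (hyperbolic_square huv) dim_vline; exact: leq_b1.
rewrite Esq (split_dim fs) => le_r.
have ge_sum : (\sum_(i | i != i1) 2 <= \sum_(i | i != i1) \dim {: Es i})%N.
  by apply: leq_sum => i _; apply: split_dim_ge2.
have := ge_sum; rewrite sum_nat_const.
have cardI : #|[pred i : 'I_r | i != i1]| = r.-1.
  by have := cardC1 i1; rewrite card_ord => <-; apply: eq_card => i; rewrite !inE.
rewrite cardI; have := split_dim_ge2 i1; rewrite (bigD1 i1) //= in le_r.
move: (\sum_(i | i != i1) \dim {: Es i})%N le_r => S le_r ge2 leS.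
have r_gt0 : (0 < r)%N := leq_ltn_trans (leq0n i1) (ltn_ord i1).
have r1 : r = 1%N by lia.
split; last by move: le_r ge2; lia.
move=> i; apply: ord_inj; have := ltn_ord i; have := ltn_ord i1; lia.
Qed.

(** Two uses of [modular_hyperbolic]. The vector u' of another block would fall into the span of [U]
    and [V], hence be orthogonal to v', against u' v' = u'. Every vector of the block [i1] falls
    into that span too, all its products being multiples of [u]. *)
Lemma split_modular_hyperbolic i1 : 2%:R != 0 :> K -> modular_alg E -> split_hyperbolic i1.
Proof.
move=> two0 mE; have EC := split_comm fs; have [u [v huv]] := Eshyp i1.
have [u0 uu vv uv mulu] := huv; have fM := split_morph fs (i:=i1).
pose U := f i1 u; pose V := f i1 v.
have UU : U ** U = 0 by rewrite -fM uu linear0.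
have VV : V ** V = 0 by rewrite -fM vv linear0.
have UV : U ** V = U by rewrite -fM uv.
have U0 : U != 0 by rewrite split_f_eq0.
split=> [i|].
  apply/eqP/negPn/negP => i_neq; have [u' [v' [u'0 u'u' _ u'v' _]]] := Eshyp i.
  have fM' := split_morph fs (i:=i).
  have Uw w : U ** f i w = 0 by rewrite (split_orth fs) // eq_sym.
  have Vw w : V ** f i w = 0 by rewrite (split_orth fs) // eq_sym.
  have : f i u' \in (<[U]> + <[V]>)%VS.
    apply: (modular_hyperbolic (a := 0) (b := 0) (c := 0) EC mE two0 U0 UU VV UV);
      by rewrite scale0r // -fM' u'u' linear0.
  case/memv_addP => _ /vlineP[a ->] [_ /vlineP[b ->] u'E].
  have : f i u' ** f i v' = 0 by rewrite u'E amulDl !amulZl Uw Vw !scaler0 addr0.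
  by move/eqP; rewrite -fM' u'v' split_f_eq0 (negPf u'0).
apply/eqP; rewrite eqn_leq split_dim_ge2 andbT -(hyperbolic_dim huv).
have : (limg (f i1) <= f i1 @: (<[u]> + <[v]>))%VS.
  apply/subvP=> _ /memv_imgP[x _ ->]; rewrite limgD !limg_line.
  have /vlineP[a ux] := mulu u x; have /vlineP[b vx] := mulu v x; have /vlineP[c xx] := mulu x x.
  by apply: (modular_hyperbolic (a := a) (b := b) (c := c) EC mE two0 U0 UU VV UV);
    rewrite -fM ?ux ?vx ?xx linearZ.
move/dimvS; rewrite !limg_dim_eq ?split_inj ?capv0 //.
Qed.

Lemma split_flag i1 u v : split_hyperbolic i1 -> hyperbolic u v ->
  flag_basis (f i1 u) (f i1 v) gs.
Proof.
case=> all1 dim1 huv; have [u0 uu vv uv mulu] := huv; have fM := split_morph fs (i:=i1).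
have limgE : (\sum_i limg (f i) = <[f i1 u]> + <[f i1 v]>)%VS.
  rewrite (bigD1 i1) //= big1 => [|i]; last by rewrite (all1 i) eqxx.
  have <- : (<[u]> + <[v]>)%VS = fullv.
    by apply/eqP; rewrite eqEdim subvf dim1 (hyperbolic_dim huv).
  by rewrite addv0 limgD !limg_line.
split.
- rewrite basisEdim (split_dim fs) (split_full fs) limgE !span_cons addvA subvv /=.
  by rewrite (bigD1 i1) //= dim1 -addnA -[X in (X <= _)%N]add2n leq_add2l leq_addl.
- by rewrite -fM uu linear0.
- by rewrite -fM vv linear0.
- by rewrite -fM uv.
- exact: (split_fg fs u).
- exact: (split_fg fs v).
- exact: (split_gg fs).
move=> i /(split_sq fs); rewrite limgE /= !span_cons addvA //.
Qed.

End Split.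

Lemma hyperbolic_iso (K : fieldType) (F : naAlgType K) (u v : F) : 2%:R != 0 :> K ->
  commutative_alg F -> hyperbolic u v -> \dim {: F} = 2%N -> alg_iso F (E2_1N1 K).
Proof.
move=> two0 FC huv dimF; have [u0 uu vv uv mulu] := huv.
(* A hyperbolic pair spanning [F] is a flag with empty tail. *)
have Fflag : flag_basis u v [::].
  split=> // [|i j]; last by rewrite ltn0 andbF.
  rewrite basisEdim dimF leqnn andbT span_cons span_seq1.
  suff -> : fullv = (<[u]> + <[v]>)%VS by apply: subvv.
  by apply/esym/eqP; rewrite eqEdim subvf dimF (hyperbolic_dim huv).
have [] := flag_hyperbolic_basis FC Fflag two0; have := flag_basis_hyperbolic Fflag two0.
set b0 := _ + v; set b1 := _ - v => bB e00 e11 e01 e10.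
pose B := [tuple b0; b1].
have natB : natural_basis B.
  by split=> // -[[|[|//]] ?] [[|[|//]] ?]; rewrite -val_eqE //= !(tnth_nth 0).
suff <- : structure_mx B = Ek_mx 2 (fun i : 'I_2 => (-1) ^+ i) by apply: natural_basis_iso.
apply/matrixP=> i j; rewrite !mxE ltn_ord (tnth_nth 0).
have c01 : coord B j (b0 + b1) = 1.
  rewrite linearD /= (coord_free 0 j (basis_free bB)) (coord_free 1 j (basis_free bB)).
  by case: j => [[|[|//]] ?]; rewrite -!val_eqE /= ?addr0 ?add0r.
by case: i => [[|[|//]] ?] /=; rewrite ?e00 ?e11 ?linearN /= c01.
Qed.

(** * The equivalences, through the dimension of the square *)

Theorem theorem6p3 (K : fieldType)
    (K_sqclosed : forall a : K, exists b, b ^+ 2 = a)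
    (K_char : 2%N \notin [pchar K])
    (r : nat) (r_gt0 : (0 < r)%N)
    (Es : 'I_r -> naAlgType K) (s k : 'I_r -> nat)
    (lam : forall i : 'I_r, 'I_(s i) -> K)
    (Bs : forall i : 'I_r, (s i).-tuple (Es i))
    (Es_form : forall i : 'I_r, Ek_basis (k i) (lam i) (Bs i))
    (Es_solvable : forall i : 'I_r, solvable_alg (Es i))
    (Es_non_nilpotent : forall i : 'I_r, ~ nilpotent_alg (Es i))
    (E : naAlgType K) (f : forall i : 'I_r, 'Hom(Es i, E))
    (E_family : family_embedding Bs f)
    (E_solvable : solvable_alg E) (E_non_nilpotent : ~ nilpotent_alg E) :
  let n := \dim {: E} in
  let i1 : 'I_r := Ordinal r_gt0 in
  let cond_iii :=
    [/\ r = 1%N, alg_iso (Es i1) (E2_1N1 K) &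
        max_nilpotency_index (quot_alg (f i1 @: alg_square (Es i1))%VS)] in
  [/\ distributive_alg E <-> modular_alg E,
      modular_alg E <-> cond_iii,
      cond_iii <-> max_solvability_index E,
      modular_alg E -> upper_semimodular_alg E &
      distributive_alg E ->
      exists B : (2 + (n - 2)).-tuple E,
        [/\ natural_basis B,
            exists C (L : 'M[K]_(n - 2)),
              [/\ structure_mx B =
                    block_mx (\matrix_(i < 2, j < 2) (-1) ^+ i) 0 C L,
                  strictly_lower L &
                  forall i j : 'I_(n - 2), i = j.+1 :> nat -> L i j != 0] &
            \rank (structure_mx B) = (n - 1)%N]].
Proof.
move=> n i1 cond_iii.
have two0 : 2%:R != 0 :> K by move: K_char; rewrite inE.
have natBs i : natural_basis (Bs i) by case: (Es_form i).
have hyp i : exists u v : Es i, hyperbolic u v.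
  exact: Ek_hyperbolic two0 (Es_form i) (Es_non_nilpotent i).
have [gs sp] := family_embedding_split natBs E_family; have EC := split_comm sp.
have [u [v huv]] := hyp i1.
have imE : (f i1 @: alg_square (Es i1) = <[f i1 u]>)%VS.
  by rewrite (hyperbolic_square huv) limg_line.
have Iideal := family_square_ideal natBs E_family i1.
have sq_flag : \dim (alg_square E) = n.-1 -> flag_basis (f i1 u) (f i1 v) gs.
  by move=> /(split_square_hyperbolic sp hyp i1) /(split_flag sp)/(_ huv).
have mod_sq : modular_alg E -> \dim (alg_square E) = n.-1.
  move=> mE; have /(split_flag sp)/(_ huv) Eflag := split_modular_hyperbolic sp hyp i1 two0 mE.
  exact: modular_flag_square EC Eflag two0 K_sqclosed mE.
have sq_distr : \dim (alg_square E) = n.-1 -> distributive_alg E.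
  by move=> Esq; apply: flag_distributive EC (sq_flag Esq) Esq two0.
have n_gt1 : (1 < n)%N.
  rewrite /n (split_dim sp) (bigD1 i1) //= -addnA.
  exact: leq_trans (split_dim_ge2 hyp i1) (leq_addr _ _).
have sq_iii : \dim (alg_square E) = n.-1 -> cond_iii.
  move=> Esq; have [all1 dim1] := split_square_hyperbolic sp hyp i1 Esq; split.
  - apply/eqP; rewrite eqn_leq r_gt0 andbT leqNgt; apply/negP=> r_gt1.
    by have := all1 (Ordinal r_gt1).
  - exact: hyperbolic_iso two0 (natural_basis_comm (natBs i1)) huv dim1.
  rewrite imE in Iideal *; exact: flag_quot_max_nilpotency EC (sq_flag Esq) Esq Iideal.
have iii_sq : cond_iii -> \dim (alg_square E) = n.-1.
  case=> _ _; apply: max_nilpotency_quot_square Iideal _ _.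
    by rewrite (limg_prods (split_morph sp (i:=i1))) prodsS ?subvf.
  by rewrite imE dim_vline; apply: leq_ltn_trans (leq_b1 _) n_gt1.
split.
- by split=> [/distributive_modular|/mod_sq].
- by split=> [/mod_sq|/iii_sq/sq_distr/distributive_modular].
- split=> [/iii_sq Esq|/(max_solvability_square n_gt1)/sq_iii//].
  exact: flag_max_solvability EC (sq_flag Esq) Esq.
- exact: modular_upper_semimodular.
move=> /distributive_modular/mod_sq Esq.
exact: flag_structure_mx EC (sq_flag Esq) two0 Esq.
Qed.
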